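(* Let $\Gamma=\Gamma_k$, $k\in\{1,2,3,4,6\}$, be an orientation-preserving crystallographic group. A generic $\Gamma$-crystallographic direction network $(\tilde G,\varphi,\tilde{\mathbf d})$ has a unique, up to translation and scaling, faithful realization if and only if its associated colored graph $(G,\bm\gamma)$ is $\Gamma$-colored-Laman.
   Context: **Groups.** $\mathrm{Euc}(2)=\mathbb R^2\rtimes O(2)$ acts on $\mathbb R^2$ by $(\mathbf v,r)\cdot\mathbf p=\mathbf v+r\mathbf p$; $R_k$ is the counterclockwise rotation about the origin by $2\pi/k$. The orientation-preserving crystallographic groups are $\Gamma_1=\mathbb Z^2$ and $\Gamma_k=\mathbb Z^2\rtimes\mathbb Z/k\mathbb Z$ for $k=2,3,4,6$, where the generator of $\mathbb Z/k\mathbb Z$ acts on $\mathbb Z^2$ by $\begin{pmatrix}-1&0\\0&-1\end{pmatrix}$, $\begin{pmatrix}0&-1\\1&-1\end{pmatrix}$, $\begin{pmatrix}0&-1\\1&0\end{pmatrix}$, $\begin{pmatrix}0&-1\\1&1\end{pmatrix}$ for $k=2,3,4,6$ respectively. Write $t_1=((1,0),0)$, $t_2=((0,1),0)$, $r_k=((0,0),1)$. The $\mathbb Z^2$ subgroup is the translation subgroup $\Lambda(\Gamma_k)$; its elements are called translations and elements outside it rotations. For $\Gamma'\le\Gamma_k$, $\Lambda(\Gamma')=\Gamma'\cap\Lambda(\Gamma_k)$. $\mathrm{Rep}(\Gamma_k)$ is the set of discrete faithful representations $\Gamma_k\to\mathrm{Euc}(2)$ (for $k=1$: by translations). For $\Gamma'\le\Gamma_k$,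 $\mathrm{rep}_{\Gamma_k}(\Gamma')$ is the dimension of the space of representations $\Gamma'\to\mathrm{Euc}(2)$ that extend to an element of $\mathrm{Rep}(\Gamma_k)$ (for $\Gamma'\le\Lambda(\Gamma_k)$ this is $0$ if $\Gamma'$ is trivial, $2$ if $\Gamma'$ is nontrivial and $k=3,4,6$, and twice the rank of $\Gamma'$ if $k=1,2$). $T(\Gamma')=0$ if $\Gamma'$ contains a rotation and $T(\Gamma')=2$ otherwise. **Possibly degenerate representations.** $\overline{\mathrm{Rep}}(\Gamma_k)$ denotes here the set of homomorphisms $\Phi:\Gamma_k\to\mathrm{Euc}(2)$ with $\Phi(t_i)=(\mathbf v_i,\mathrm{Id})$ and, for $k\ge2$, $\Phi(r_k)=(\mathbf w,R_k)$, where $\mathbf v_i,\mathbf w\in\mathbb R^2$ are arbitrary (possibly zero or dependent), subject to $\mathbf v_2=R_k\mathbf v_1$ when $k=3,4,6$. $\Phi$ is trivial if $\Phi(\Lambda(\Gamma_k))$ is trivial. **Direction networks.** A $\Gamma$-crystallographic direction network $(\tilde G,\varphi,\tilde{\mathbf d})$ is an infinite graph $\tilde G=(\tilde V,\tilde E)$ with a $\Gamma$-action $\varphi$ by automorphisms, free on vertices and edges, with finite quotient, and a direction $\tilde{\mathbf d}_{ij}\in\mathbb R^2\setminus\{0\}$ for each edge, which is equivariant: $\tilde{\mathbf d}_{\gamma\cdot ij}=\Phi(\gamma)_r\,\tilde{\mathbf d}_{ij}$, where the rotational part $\Phi(\gamma)_r$ equals $R_k^{s}$ for $\gamma=(t,s)$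 (and $\mathrm{Id}$ for $k=1$). Thus $\tilde{\mathbf d}$ is determined by the directions on one representative edge of each of the $m$ edge orbits. A realization $\tilde G(\mathbf p,\Phi)$ is a choice of points $(\mathbf p_i)_{i\in\tilde V}$ in $\mathbb R^2$ and $\Phi\in\overline{\mathrm{Rep}}(\Gamma)$ with $\langle\mathbf p_j-\mathbf p_i,\tilde{\mathbf d}_{ij}^\perp\rangle=0$ for all $ij\in\tilde E$ and $\mathbf p_{\gamma(i)}=\Phi(\gamma)\cdot\mathbf p_i$ for all $\gamma\in\Gamma$, $i\in\tilde V$. An edge $ij$ is collapsed if $\mathbf p_i=\mathbf p_j$. A realization is faithful if no edge is collapsed and $\Phi$ is not trivial. A translation or scaling $\psi$ of the plane acts on realizations by $(\mathbf p,\Phi)\mapsto(\psi\circ\mathbf p,\psi\Phi(\cdot)\psi^{-1})$. ''Generic'' means: for each fixed $(\tilde G,\varphi)$, the statement holds for all direction assignments outside some proper algebraic subset of $\mathbb R^{2m}$. **Colored quotient.** A $\Gamma$-colored graph $(G,\bm\gamma)$ is a finite directed multigraph $G$ (self-loops and multiple edges allowed) with a color $\gamma_{ij}\in\Gamma$ on each edge. The colored graph associated with $(\tilde G,\varphi)$ has underlying graph $G=\tilde G/\Gamma$ with an arbitrary orientation; choose a representative $\tilde i$ of each vertex orbit; for each edge orbit, the unique edge in it with tail a representative $\tilde i$ has head $\gamma_{ij}(\tilde j)$ for a unique $\gamma_{ij}\in\Gamma$, the color of $ij$. **$\Gamma$-colored-Laman graphs.** For a colored graph with connected components $G_1,\dots,G_c$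 and base vertices $b_i\in V(G_i)$, let $\rho:\pi_1(G_i,b_i)\to\Gamma_k$ send a closed path to the ordered product of the colors of its edges (inverted on edges crossed backwards). Put $T(G_i)=T(\rho(\pi_1(G_i,b_i)))$ and $\mathrm{rep}_{\Gamma_k}(G)=\mathrm{rep}_{\Gamma_k}\big(\langle\Lambda(\rho(\pi_1(G_i,b_i))):1\le i\le c\rangle\big)$; these do not depend on the base vertices. For a colored graph with $n$ vertices, let $f(G)=2n+\mathrm{rep}_{\Gamma_k}(G)-\sum_{i=1}^cT(G_i)$ and $h(G)=f(G)-1$. $(G,\bm\gamma)$ with $n$ vertices and $m$ edges is $\Gamma$-colored-Laman if $m=2n+\mathrm{rep}_{\Gamma_k}(\Lambda(\Gamma_k))-T(\Gamma_k)-1$ and every subgraph $G'$ with $m'\ge1$ edges satisfies $m'\le h(G')$. *)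

(* Defs.v *)
From HB Require Import structures.
From mathcomp Require Import all_boot all_order all_algebra.
From mathcomp Require Import all_classical all_reals all_analysis.
(* The notations of mpoly clash with those of the analysis library. *)
From mathcomp Require Import (canonicals) mpoly.

Set Implicit Arguments.
Unset Strict Implicit.
Unset Printing Implicit Defensive.

Import Order.TTheory GRing.Theory Num.Theory.
Import numFieldNormedType.Exports.

Local Open Scope classical_set_scope.
Local Open Scope ring_scope.

Definition mx2 (T : Type) (a b c d : T) : 'M[T]_2 :=
  \matrix_(i, j) if i == 0 then if j == 0 then a else b
                 else if j == 0 then c else d.

Lemma mulmx2 (T : pzSemiRingType) (a b c d a' b' c' d' : T) :
  mx2 a b c d *m mx2 a' b' c' d' =
  mx2 (a * a' + b * c') (a * b' + b * d') (c * a' + d * c') (c * b' + d * d').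
Proof.
by apply/matrixP=> i j; rewrite !mxE !big_ord_recl big_ord0 !mxE /= addr0;
  case: ifP; case: ifP.
Qed.

Lemma mx2_1 (T : pzSemiRingType) : mx2 1 0 0 1 = 1%:M :> 'M[T]_2.
Proof. by apply/matrixP=> -[[|[|]] // ?] [[|[|]] // ?]; rewrite !mxE. Qed.

(* The orientation-preserving wallpaper groups, named after the order of their
   rotations. *)
Inductive crystal := P1 | P2 | P3 | P4 | P6.

Definition order_of (k : crystal) : nat :=
  match k with P1 => 1 | P2 => 2 | P3 => 3 | P4 => 4 | P6 => 6 end.

Definition lattice_mx (k : crystal) : 'M[int]_2 :=
  match k with
  | P1 => 1%:M
  | P2 => mx2 (-1) 0 0 (-1)
  | P3 => mx2 0 (-1) 1 (-1)
  | P4 => mx2 0 (-1) 1 0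
  | P6 => mx2 0 (-1) 1 1
  end.

Lemma lattice_mx_order k : lattice_mx k ^+ (order_of k).-1.+1 = 1.
Proof.
by case: k; rewrite -[RHS]/(1%:M) /= ?expr1 // !exprS expr0 mulr1 -!mulmxE !mulmx2
  -mx2_1; congr mx2.
Qed.

(* Z/k is carried by 'I_(k.-1.+1), which has k elements also for k = 1, whereas
   'Z_1 has two. *)
Definition Gam (k : crystal) : Type := ('cV[int]_2 * 'I_(order_of k).-1.+1)%type.

HB.instance Definition _ k := Choice.on (Gam k).

Section GamGroup.
Variable k : crystal.
Implicit Types g h : Gam k.

Definition Gam_one : Gam k := (0, 0).
Definition Gam_mul g h : Gam k :=
  (g.1 + lattice_mx k ^+ (g.2 : nat) *m h.1, g.2 + h.2).
Definition Gam_inv g : Gam k :=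
  (- (lattice_mx k ^+ ((- g.2)%R : nat) *m g.1), - g.2).

Let latD (a b : 'I_(order_of k).-1.+1) :
  lattice_mx k ^+ ((a + b)%R : nat) = lattice_mx k ^+ a *m lattice_mx k ^+ b.
Proof. by rewrite mulmxE -exprD /= expr_mod // lattice_mx_order. Qed.

Let lat0 : lattice_mx k ^+ ((0%R : 'I_(order_of k).-1.+1) : nat) = 1%:M.
Proof. by rewrite expr0. Qed.

Fact Gam_mulA : associative Gam_mul.
Proof.
move=> [a s] [b t] [c u]; rewrite /Gam_mul /= addrA latD.
by rewrite mulmxDr mulmxA addrA.
Qed.

Fact Gam_mul1g : left_id Gam_one Gam_mul.
Proof. by move=> [a s]; rewrite /Gam_mul lat0 mul1mx !add0r. Qed.

Fact Gam_mulg1 : right_id Gam_one Gam_mul.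
Proof. by move=> [a s]; rewrite /Gam_mul /= mulmx0 !addr0. Qed.

Fact Gam_mulVg : left_inverse Gam_one Gam_inv Gam_mul.
Proof. by move=> [a s]; rewrite /Gam_mul /Gam_inv /= !addNr. Qed.

Fact Gam_mulgV : right_inverse Gam_one Gam_inv Gam_mul.
Proof.
move=> [a s]; have E : lattice_mx k ^+ s *m (lattice_mx k ^+ ((- s)%R : nat) *m a) = a.
  by rewrite mulmxA -latD subrr lat0 mul1mx.
by congr pair; rewrite /= ?subrr // mulmxN E subrr.
Qed.

HB.instance Definition _ := isGroup.Build (Gam k)
  Gam_mulA Gam_mul1g Gam_mulg1 Gam_mulVg Gam_mulgV.

Definition t_ (i : 'I_2) : Gam k := (delta_mx i 0, 0).
Definition r_ : Gam k := (0, inZp 1).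

Definition is_translation g := g.2 = 0.
Definition is_rotation g := g.2 <> 0.

Definition Lambda (H : set (Gam k)) : set (Gam k) := H `&` is_translation.

Definition is_subgroup (H : set (Gam k)) :=
  H 1%g /\ forall g h, H g -> H h -> H (g * h^-1)%g.

Definition generated (A : set (Gam k)) : set (Gam k) := smallest is_subgroup A.

Definition T_ (H : set (Gam k)) : nat :=
  if `[< exists2 g, H g & is_rotation g >] then 0%N else 2%N.

End GamGroup.

Section Euc.
Variable R : realType.

Record euc := Euc {
  euc_parts : 'cV[R]_2 * 'M[R]_2;
  _ : euc_parts.2^T *m euc_parts.2 == 1%:M }.

HB.instance Definition _ := [isSub for euc_parts].
HB.instance Definition _ := [Choice of euc by <:].

Definition etrans (x : euc) : 'cV[R]_2 := (euc_parts x).1.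
Definition erot (x : euc) : 'M[R]_2 := (euc_parts x).2.

Lemma erotTK x : (erot x)^T *m erot x = 1%:M.
Proof. by apply/eqP; case: x. Qed.

Lemma erotKT x : erot x *m (erot x)^T = 1%:M.
Proof. exact/mulmx1C/erotTK. Qed.

Lemma euc_eq x y : etrans x = etrans y -> erot x = erot y -> x = y.
Proof.
case: x y => [[v r] ?] [[v' r'] ?] /= ev er.
by apply: val_inj; rewrite /= /etrans /erot /= in ev er *; rewrite ev er.
Qed.

Fact euc_one_subproof :
  ((0, 1%:M) : 'cV[R]_2 * 'M[R]_2).2^T *m 1%:M == 1%:M.
Proof. by rewrite /= trmx1 mulmx1. Qed.
Definition euc_one : euc := @Euc (0, 1%:M) euc_one_subproof.

Fact euc_mul_subproof x y :
  (erot x *m erot y)^T *m (erot x *m erot y) == 1%:M.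
Proof.
by rewrite trmx_mul -mulmxA (mulmxA (erot x)^T) erotTK mul1mx erotTK.
Qed.
Definition euc_mul x y : euc :=
  @Euc (etrans x + erot x *m etrans y, erot x *m erot y) (euc_mul_subproof x y).

Fact euc_inv_subproof x : (erot x)^T^T *m (erot x)^T == 1%:M.
Proof. by rewrite trmxK erotKT. Qed.
Definition euc_inv x : euc :=
  @Euc (- ((erot x)^T *m etrans x), (erot x)^T) (euc_inv_subproof x).

Let etrans1 : etrans euc_one = 0. Proof. by []. Qed.
Let erot1 : erot euc_one = 1%:M. Proof. by []. Qed.
Let etransM x y : etrans (euc_mul x y) = etrans x + erot x *m etrans y.
Proof. by []. Qed.
Let erotM x y : erot (euc_mul x y) = erot x *m erot y. Proof. by []. Qed.
Let etransV x : etrans (euc_inv x) = - ((erot x)^T *m etrans x).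
Proof. by []. Qed.
Let erotV x : erot (euc_inv x) = (erot x)^T. Proof. by []. Qed.
Let eucE := (etrans1, erot1, etransM, erotM, etransV, erotV).

Fact euc_mulA : associative euc_mul.
Proof.
by move=> x y z; apply: euc_eq; rewrite !eucE ?mulmxDr ?mulmxA ?addrA.
Qed.

Fact euc_mul1g : left_id euc_one euc_mul.
Proof. by move=> x; apply: euc_eq; rewrite !eucE mul1mx ?add0r. Qed.

Fact euc_mulg1 : right_id euc_one euc_mul.
Proof. by move=> x; apply: euc_eq; rewrite !eucE ?mulmx0 ?addr0 ?mulmx1. Qed.

Fact euc_mulVg : left_inverse euc_one euc_inv euc_mul.
Proof. by move=> x; apply: euc_eq; rewrite !eucE ?addNr ?erotTK. Qed.

Fact euc_mulgV : right_inverse euc_one euc_inv euc_mul.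
Proof.
by move=> x; apply: euc_eq; rewrite !eucE ?erotKT // mulmxN mulmxA erotKT mul1mx subrr.
Qed.

HB.instance Definition _ := isGroup.Build euc
  euc_mulA euc_mul1g euc_mulg1 euc_mulVg euc_mulgV.

Definition eapp (x : euc) (p : 'cV[R]_2) : 'cV[R]_2 := etrans x + erot x *m p.

Definition rotR (k : crystal) : 'M[R]_2 :=
  let a := 2 * pi / (order_of k)%:R in mx2 (cos a) (- sin a) (sin a) (cos a).

End Euc.

Section Algebraic.
Variable R : realType.

Definition algebraic_set (I : finType) (A : set (I -> R)) :=
  exists S : set (mpoly.mpoly #|I| R),
    A = [set x | forall P, S P ->
                   mpoly.meval (fun j => x (enum_val j)) P = 0].

Definition proper_algebraic_set (I : finType) (A : set (I -> R)) :=
  algebraic_set A /\ A <> [set: I -> R].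

Definition algebraically_independent (I : Type) (X : set (I -> R))
    (d : nat) (s : 'I_d -> I) :=
  forall P : mpoly.mpoly d R,
    (forall x, X x -> mpoly.meval (fun j => x (s j)) P = 0) -> P = 0.

(* The dimension of X is that of its Zariski closure: the largest number of
   coordinate functions that satisfy no polynomial relation on X. For a
   semialgebraic X this is the topological dimension. I may be infinite, and
   the default value 0 is taken if the number is unbounded. *)
Definition adim (I : Type) (X : set (I -> R)) : nat :=
  xget 0%N [set d |
    (exists s : 'I_d -> I, algebraically_independent X s) /\
    (forall d' (s : 'I_d' -> I), algebraically_independent X s -> (d' <= d)%N)].

End Algebraic.

Section Representations.
Variables (R : realType) (k : crystal).
Implicit Type Phi : Gam k -> euc R.

Definition is_hom Phi := {morph Phi : g h / (g * h)%g}.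

Definition discrete_image Phi :=
  let A := range (fun g => euc_parts (Phi g)) in A `<=` isolated A.

Definition Rep : set (Gam k -> euc R) :=
  [set Phi | [/\ is_hom Phi, injective Phi, discrete_image Phi &
                 k = P1 -> forall g, erot (Phi g) = 1%:M]].

Definition extendable_reps (H : set (Gam k)) : set (H -> euc R) :=
  [set phi | exists2 Phi, Rep Phi & forall g : H, phi g = Phi (\val g)].

Definition euc_coord (x : euc R) (c : 'I_2 + 'I_2 * 'I_2) : R :=
  match c with inl i => etrans x i 0 | inr (i, j) => erot x i j end.

(* The dimension of extendable_reps H, in the coordinates given by the entries of
   phi g for g in H. *)
Definition rep (H : set (Gam k)) : nat :=
  adim [set (fun gc : H * ('I_2 + 'I_2 * 'I_2) => euc_coord (phi gc.1) gc.2)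
         | phi in @extendable_reps H].

(* Possibly degenerate representations. Given is_hom, the last condition follows
   from the others, since lattice_mx maps the first basis vector to the second. *)
Definition Rep_bar : set (Gam k -> euc R) :=
  [set Phi | [/\ is_hom Phi,
                 forall i, erot (Phi (t_ k i)) = 1%:M,
                 k <> P1 -> erot (Phi (r_ k)) = rotR R k &
                 k = P3 \/ k = P4 \/ k = P6 ->
                   etrans (Phi (t_ k 1)) = rotR R k *m etrans (Phi (t_ k 0))]].

Definition trivial_rep Phi := forall g, Lambda setT g -> Phi g = 1%g.

Definition rot_part (g : Gam k) : 'M[R]_2 :=
  if k is P1 then 1%:M else rotR R k ^+ (g.2 : nat).

End Representations.

Section SymmetricGraphs.
Variable k : crystal.

Definition is_action (X : Type) (act : Gam k -> X -> X) :=
  (forall x, act 1%g x = x) /\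
  (forall g h x, act (g * h)%g x = act g (act h x)).

Definition free_action (X : Type) (act : Gam k -> X -> X) :=
  forall g x, act g x = x -> g = 1%g.

Definition finite_quotient (X : Type) (act : Gam k -> X -> X) :=
  finite_set (range (fun x => range (act^~ x))).

Definition same_ends (X : Type) (p q : X * X) := p = q \/ p = (q.2, q.1).

(* An undirected multigraph: gends lists the two ends of an edge in an order
   without significance. Parallel edges and loops are allowed, so that every
   colored graph is the quotient of some graph. *)
Record sym_graph := SymGraph {
  gvert : Type;
  gedge : Type;
  gends : gedge -> gvert * gvert;
  vact : Gam k -> gvert -> gvert;
  eact : Gam k -> gedge -> gedge;
  _ : infinite_set [set: gvert];
  _ : is_action vact;
  _ : is_action eact;
  _ : forall g e, same_ends (gends (eact g e))
                            (vact g (gends e).1, vact g (gends e).2);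
  _ : free_action vact;
  _ : free_action eact;
  _ : finite_quotient vact;
  _ : finite_quotient eact }.

Record colored_graph := ColoredGraph {
  cvert : finType;
  cedge : finType;
  ctail : cedge -> cvert;
  chead : cedge -> cvert;
  color : cedge -> Gam k }.

Definition orbit_representatives (X Y : Type) (act : Gam k -> X -> X)
    (s : Y -> X) :=
  forall x, exists! y, exists g, x = act g (s y).

(* The orientation of the quotient is arbitrary because the two ends of erep e
   may be listed in either order. *)
Definition associated (G : sym_graph) (C : colored_graph)
    (vrep : cvert C -> gvert G) (erep : cedge C -> gedge G) :=
  [/\ orbit_representatives (@vact G) vrep,
      orbit_representatives (@eact G) erep &
      forall e : cedge C,
        same_ends (gends (erep e))
                  (vrep (ctail e), vact (color e) (vrep (chead e)))].

End SymmetricGraphs.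

Section DirectionNetworks.
Variables (R : realType) (k : crystal) (G : sym_graph k).

Definition dot (u v : 'cV[R]_2) : R := \sum_i u i 0 * v i 0.

Definition perp (u : 'cV[R]_2) : 'cV[R]_2 := mx2 0 (-1) 1 0 *m u.

Definition is_direction_network (d : gedge G -> 'cV[R]_2) :=
  (forall e, d e <> 0) /\
  (forall g e, d (eact g e) = rot_part R g *m d e).

Definition is_realization (d : gedge G -> 'cV[R]_2)
    (p : gvert G -> 'cV[R]_2) (Phi : Gam k -> euc R) :=
  [/\ Rep_bar Phi,
      forall e, dot (p (gends e).2 - p (gends e).1) (perp (d e)) = 0 &
      forall g x, p (vact g x) = eapp (Phi g) (p x)].

Definition collapsed (p : gvert G -> 'cV[R]_2) (e : gedge G) :=
  p (gends e).1 = p (gends e).2.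

Definition is_faithful_realization d p Phi :=
  [/\ is_realization d p Phi, forall e, ~ collapsed p e & ~ trivial_rep Phi].

(* The maps a x + u with a nonzero, possibly negative, are the compositions of
   translations and scalings. The last equation says Phi' g = psi (Phi g) psi^-1,
   where psi is the map. *)
Definition equivalent_realizations (p : gvert G -> 'cV[R]_2) Phi
    (p' : gvert G -> 'cV[R]_2) Phi' :=
  exists (a : R) (u : 'cV[R]_2),
    let psi x := a *: x + u in
    [/\ a <> 0,
        forall i, p' i = psi (p i) &
        forall (g : Gam k) x, eapp (Phi' g) (psi x) = psi (eapp (Phi g) x)].

Definition has_unique_faithful_realization (d : gedge G -> 'cV[R]_2) :=
  exists p Phi, is_faithful_realization d p Phi /\
    forall p' Phi', is_faithful_realization d p' Phi' ->
      equivalent_realizations p Phi p' Phi'.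

(* R^2m has the coordinates of the directions of the m representative edges. *)
Definition generically (E : finType) (erep : E -> gedge G)
    (Q : (gedge G -> 'cV[R]_2) -> Prop) :=
  exists2 A : set (E * 'I_2 -> R), proper_algebraic_set A &
    forall d, is_direction_network d ->
      ~ A (fun ei => d (erep ei.1) ei.2 0) -> Q d.

End DirectionNetworks.

Section ColoredLaman.
Variables (R : realType) (k : crystal) (C : colored_graph k).
Implicit Types (V : {set cvert C}) (E : {set cedge C}).

Definition is_subgraph V E :=
  forall e, e \in E -> ctail e \in V /\ chead e \in V.

Inductive walk_color E : cvert C -> cvert C -> Gam k -> Prop :=
| walk_nil x : walk_color E x x 1%g
| walk_forward e y g : e \in E ->
    walk_color E (chead e) y g -> walk_color E (ctail e) y (color e * g)%g
| walk_backward e y g : e \in E ->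
    walk_color E (ctail e) y g ->
    walk_color E (chead e) y ((color e)^-1 * g)%g.

Definition rho E (b : cvert C) : set (Gam k) := [set g | walk_color E b b g].

Definition adjacent E : rel (cvert C) := fun x y =>
  [exists e in E, ((ctail e == x) && (chead e == y)) ||
                  ((ctail e == y) && (chead e == x))].

(* One vertex in each connected component of (V, E): a root as in fingraph. The
   quantities below do not depend on which vertex it is. *)
Definition base_vertices V E : {set cvert C} :=
  [set b in V | roots (adjacent E) b].

Definition rep_graph V E : nat :=
  rep R (generated (\bigcup_(b in [set` base_vertices V E]) Lambda (rho E b))).

Definition laman_f V E : int :=
  (2 * #|V| + rep_graph V E)%:Z - (\sum_(b in base_vertices V E) T_ (rho E b))%:Z.

Definition laman_h V E : int := laman_f V E - 1.

Definition colored_laman :=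
  #|cedge C|%:Z = (2 * #|cvert C| + rep R (Lambda [set: Gam k]))%:Z
                    - (T_ [set: Gam k])%:Z - 1 /\
  forall V E, is_subgraph V E -> (1 <= #|E|)%N -> #|E|%:Z <= laman_h V E.

End ColoredLaman.

(* Main.v *)
From HB Require Import structures.
From mathcomp Require Import all_boot all_order all_algebra.
From mathcomp Require Import zify ring lra.
From mathcomp Require Import all_classical all_reals all_analysis.
From mathcomp Require Import (canonicals, coercions) mpoly.
Require Import Defs.

(* Put V = {M | M A = R M}, where A is the action of the generating rotation on
   the lattice and R is the rotation of the plane. After a translation, a
   realization is a point (q, M) of a linear space X, where q gives the positions
   of the vertex representatives and M in V the images of the lattice vectors;
   the constraint on an edge e with direction d_e says that a linear function
   S_e : X -> R^2 takes a value parallel to d_e. If K_F is the subspace of X on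
   which all the edges of F are collapsed, then
     codim K_F = 2 n + rep - sum T = f(F),
   so that, by Rado's theorem on independent representatives of subspaces, the
   constraints on F are independent for generic d as soon as |F'| <= f(F') for all
   subsets F' of F. Replacing one S_e by a pair of constraints, or adding
   a generic constraint on M, one gets from |F| <= f(F) - 1 that, generically,
   solutions with a collapsed edge or with M = 0 are trivial. Conversely a minimal
   violation of |F| <= f(F) - 1 forces the edges of F to collapse, and too few
   edges leave room to perturb a faithful realization. *)

Set Implicit Arguments.
Unset Strict Implicit.
Unset Printing Implicit Defensive.

Import Order.TTheory GRing.Theory Num.Theory.
Import numFieldNormedType.Exports.

Local Open Scope classical_set_scope.
Local Open Scope ring_scope.

(** * Rado's theorem for subspaces, in dual form *)

(** Rado's theorem only yields abstract hyperplanes. They become direction constraints because [S_e]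
    takes values in a plane: a linear form vanishing on the kernel of [S_e] is the determinant of
    [S_e] against some direction. One good choice of directions is enough, since the rank of a
    polynomial system can only grow at generic points. The summand -1 in [h] leaves room for one
    more hyperplane, taken around a subspace of unwanted solutions (one edge collapsed, or M = 0).
    It cuts the solutions down to the trivial ones, whose dimension T(Gamma) is that of the
    translations that remain once the rotation center is placed at the origin. The obstacle is
    [rep], defined through algebraic independence of coordinates on discrete faithful
    representations. These are not assumed to send translations to translations, which has to be
    deduced from discreteness, and they may turn the generating rotation in the opposite sense, so
    that their lattice matrices lie either in V or in its mirror image. *)

Section DualRado.
Variables (K : fieldType) (vT : vectType K) (I : finType) (X : {vspace vT})
  (G : {set I}).
Implicit Types (U : I -> {vspace vT}) (F : {set I}).

Definition caps U F : {vspace vT} := (X :&: \bigcap_(i in F) U i)%VS.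

(* Rado's condition for the annihilators of the [U i] in the dual of [X]. *)
Definition rado U := forall F, F \subset G -> (#|F| + \dim (caps U F) <= \dim X)%N.

Lemma memv_caps U F x :
  (x \in caps U F) = (x \in X) && [forall (i | i \in F), x \in U i].
Proof.
rewrite memv_cap; congr andb; rewrite memvE.
by apply/subv_bigcapP/forall_inP => h i /h; rewrite memvE.
Qed.

Lemma caps_sub U F : (caps U F <= X)%VS.
Proof. exact: capvSl. Qed.

Definition upd U i V j := if j == i then V else U j.

Lemma caps_upd_notin U F i V : i \notin F -> caps (upd U i V) F = caps U F.
Proof.
move=> iF; congr capv; apply: eq_bigr => j jF; rewrite /upd; case: eqP => // e.
by rewrite -e jF in iF.
Qed.

Lemma caps_upd_in U F i V : i \in F ->
  caps (upd U i V) F = (caps U (F :\ i) :&: V)%VS.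
Proof.
move=> iF; apply/vspaceP => x; rewrite memv_cap !memv_caps -andbA; congr andb.
apply/forall_inP/andP => [h|[/forall_inP h xV] j jF].
  split; last by have := h _ iF; rewrite /upd eqxx.
  by apply/forall_inP => j /setD1P[ji /h]; rewrite /upd (negPf ji).
by rewrite /upd; case: eqP => [//|/eqP ji]; apply: h; rewrite !inE ji.
Qed.

(* Submodularity: the two violated constraints would add up to a violation for
   [U] itself, at the union with [i] and at the intersection. *)
Lemma rado_upd U i V1 V2 : i \in G -> rado U -> (V1 :&: V2 <= U i)%VS ->
  rado (upd U i V1) \/ rado (upd U i V2).
Proof.
move=> iG radoU sV; apply: contrapT => /not_orP[].
move=> /existsNP[F1 /not_implyP[FG1 n1]] /existsNP[F2 /not_implyP[FG2 n2]].
have violated V F : F \subset G -> ~ (#|F| + \dim (caps (upd U i V) F) <= \dim X)%N ->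
    i \in F /\ (\dim X <= #|F :\ i| + \dim (caps U (F :\ i) :&: V))%N.
  move=> FG; have radoF := radoU _ FG.
  case: (boolP (i \in F)) => iF; last by rewrite caps_upd_notin.
  by rewrite caps_upd_in // (cardsD1 i F) iF; split=> //; lia.
have [i1 {}n1] := violated _ _ FG1 n1; have [i2 {}n2] := violated _ _ FG2 n2.
set G1 := F1 :\ i in n1; set G2 := F2 :\ i in n2.
set A1 := (_ :&: V1)%VS in n1; set A2 := (_ :&: V2)%VS in n2.
have dA := dimv_sum_cap A1 A2.
have sU : (A1 :&: A2 <= caps U (i |: (G1 :|: G2)))%VS.
  apply/subvP => x; rewrite !(memv_cap, memv_caps).
  move=> /andP[/andP[/andP[-> /forall_inP h1] x1] /andP[/andP[_ /forall_inP h2] x2]] /=.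
  apply/forall_inP => j /setU1P[->|/setUP[/h1|/h2] //].
  by apply: (subvP sV); rewrite memv_cap x1.
have sI : (A1 + A2 <= caps U (G1 :&: G2))%VS.
  rewrite subv_add; apply/andP; split; apply/subvP => x; rewrite !(memv_cap, memv_caps);
    move=> /andP[/andP[-> /forall_inP h] _] /=; apply/forall_inP => j /setIP[? ?]; exact: h.
have := dimvS sU; have := dimvS sI.
have G1G : G1 \subset G := fintype.subset_trans (finset.subsetDl _ _) FG1.
have G2G : G2 \subset G := fintype.subset_trans (finset.subsetDl _ _) FG2.
have := radoU (i |: (G1 :|: G2)); rewrite !finset.subUset finset.sub1set iG G1G G2G => /(_ isT).
have := radoU (G1 :&: G2) (fintype.subset_trans (finset.subsetIl _ _) G1G).
rewrite cardsU1 !inE eqxx /=; have := cardsUI G1 G2; lia.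
Qed.

(** Adjoin to [U] a vector of [X], or else a complement of the resulting [V1]. In codimension at
    least two both enlargements are proper, and they meet only in [U], as [rado_upd] requires. *)
Lemma capv_enlarge (U : {vspace vT}) : (U <= X)%VS -> (\dim U + 2 <= \dim X)%N ->
  exists V1 V2, [/\ (V1 :&: V2 <= U)%VS, (U <= V1 <= X)%VS, (U <= V2 <= X)%VS,
    (\dim U < \dim V1)%N & (\dim U < \dim V2)%N].
Proof.
move=> UX dU; have /subvPn[v vX vU] : ~~ (X <= U)%VS.
  by apply/negP => /dimvS; lia.
pose V1 := (U + <[v]>)%VS; pose V2 := (U + (X :\: V1))%VS.
have UV1 : (U <= V1)%VS by rewrite addvSl.
have UV2 : (U <= V2)%VS by rewrite addvSl.
have vV1 : v \in V1 by rewrite memvE addvSr.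
have V1X : (V1 <= X)%VS by rewrite subv_add UX -memvE.
have V2X : (V2 <= X)%VS by rewrite subv_add UX diffvSl.
have V12 : (V1 + V2)%VS = X.
  apply/eqP; rewrite eqEsubv subv_add V1X V2X /=.
  have e : (X :\: V1 + V1)%VS = X by rewrite addv_diff; exact/addv_idPl.
  by rewrite -{1}e addvC addvS ?subvv ?addvSr.
have dV1 : (\dim V1 <= (\dim U).+1)%N.
  have := dimv_sum_cap U <[v]>; rewrite -/V1 dim_vline; lia.
have dV1' : (\dim U < \dim V1)%N.
  rewrite ltn_neqAle (dimvS UV1) andbT; apply/negP => dUV.
  have /eqP e : U == V1 by rewrite eqEdim UV1 (eqP dUV) leqnn.
  by move: vU; rewrite e vV1.
have dd := dimv_cap_compl X V1; rewrite (capv_idPr V1X) in dd.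
have d2 := dimv_sum_cap U (X :\: V1); rewrite -/V2 in d2.
have d12 := dimv_sum_cap V1 V2; rewrite V12 in d12.
have UI : (U <= V1 :&: V2)%VS by rewrite subv_cap UV1 UV2.
have dI := dimvS UI.
exists V1, V2; split; rewrite ?UV1 ?UV2 //; last lia.
have /eqP <- // : U == (V1 :&: V2)%VS by rewrite eqEdim UI; lia.
Qed.

(** Induction on the total codimension: a subspace of codimension at least two has two enlargements,
    and by [rado_upd] one of them keeps Rado's condition. In the end [rado H], taken at [G] itself,
    says that the hyperplanes are independent. *)
Theorem dual_rado U : (forall i, U i <= X)%VS -> rado U ->
  exists H, [/\ forall i, (U i <= H i <= X)%VS,
    forall i, i \in G -> (\dim X <= (\dim (H i)).+1)%N & rado H].
Proof.
have [n] := ubnP (\sum_i (\dim X - \dim (U i)))%N.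
elim: n U => // n IH U lt_n UX radoU.
have [small|/forall_inPn[i iG]] := boolP [forall (i | i \in G), (\dim X <= (\dim (U i)).+1)%N].
  by exists U; split=> // i; rewrite ?subvv ?UX //; exact: (forall_inP small).
rewrite -ltnNge => big; have [//|V1 [V2 [VU s1 s2 d1 d2]]] := capv_enlarge (UX i).
  by lia.
have step V : (U i <= V <= X)%VS -> (\dim (U i) < \dim V)%N -> rado (upd U i V) ->
    exists H, [/\ forall i, (U i <= H i <= X)%VS,
      forall i, i \in G -> (\dim X <= (\dim (H i)).+1)%N & rado H].
  move=> /andP[sU sX] dV radoV.
  have [||//|H [UH dH rH]] := IH (upd U i V).
  - move: lt_n; rewrite ltnS; apply: leq_trans.
    rewrite (bigD1 i) //= [leqRHS](bigD1 i) //= /upd eqxx -addSn leq_add //; first lia.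
    by apply: leq_sum => j /negPf ->.
  - by move=> j; rewrite /upd; case: eqP.
  exists H; split=> // j; have /andP[Uj ->] := UH j; rewrite andbT.
  by apply: subv_trans Uj; rewrite /upd; case: eqP => [->|].
by have [/step|/step] := rado_upd iG radoU VU; apply.
Qed.

End DualRado.

(** * Generic points *)

Section PolynomialFunctions.
Variable K : numFieldType.

Lemma poly_fun_eq0 (q : {poly K}) : (forall t, q.[t] = 0) -> q = 0.
Proof.
move=> q0; apply/eqP/negPn/negP => /max_poly_roots - /(_ [seq i%:R | i <- iota 0 (size q)]).
rewrite size_map size_iota ltnn => h; suff: false by []; apply: h.
  by apply/allP => x _; apply/rootP.
by rewrite map_inj_uniq ?iota_uniq // => i j /eqP; rewrite eqr_nat => /eqP.
Qed.

Lemma digits_inj n (B : nat) (a b : 'I_n -> nat) :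
  (forall i, a i < B)%N -> (forall i, b i < B)%N ->
  (\sum_i a i * B ^ i = \sum_i b i * B ^ i)%N -> a =1 b.
Proof.
elim: n a b => [|n IH] a b aB bB; first by move=> _ [].
have B0 : (0 < B)%N by apply: leq_ltn_trans (aB ord0).
rewrite !big_ord_recl expn0 !muln1.
have E (c : 'I_n.+1 -> nat) : (\sum_(i < n) c (lift ord0 i) * B ^ lift ord0 i =
    (\sum_(i < n) c (lift ord0 i) * B ^ i) * B)%N.
  by rewrite big_distrl /=; apply: eq_bigr => i _; rewrite /bump /= add1n expnSr mulnA.
rewrite !E => e.
have e0 : a ord0 = b ord0.
  by have := congr1 (modn^~ B) e; rewrite /= ![(_ + _ * B)%N]addnC !modnMDl !modn_small.
move: e; rewrite e0 => /addnI /eqP; rewrite eqn_pmul2r // => /eqP /IH e i.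
case: (unliftP ord0 i) => [j ->|-> //]; exact: e.
Qed.

(* Kronecker's substitution sends distinct monomials to distinct powers. *)
Lemma meval_eq0 n (P : mpoly.mpoly n K) :
  (forall v, mpoly.meval v P = 0) -> P = 0.
Proof.
(* The base exceeds every exponent, since each exponent is bounded by the degree of its own
   monomial. *)
move=> P0; pose B := (\sum_(m <- mpoly.msupp P) mpoly.mdeg m).+1.
pose e (m : mpoly.multinom n) := (\sum_i m i * B ^ i)%N.
have mB m i : m \in mpoly.msupp P -> (m i < B)%N.
  move=> mP; rewrite ltnS (big_rem m) //= mpoly.mdegE (bigD1 i) //=.
  by rewrite -addnA leq_addr.
pose q := \sum_(m <- mpoly.msupp P) mpoly.mcoeff m P *: 'X^(e m).
have q0 : q = 0.
  apply: poly_fun_eq0 => t; rewrite -(P0 (fun i => t ^+ (B ^ i))) mpoly.mevalE.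
  rewrite horner_sum; apply: eq_bigr => m _; rewrite hornerZ hornerXn.
  by rewrite /e -prodrXr; congr (_ * _); apply: eq_bigr => i _; rewrite -exprM mulnC.
apply/mpoly.mpolyP => m; rewrite mpoly.mcoeff0; apply/eqP; rewrite mpoly.mcoeff_eq0.
apply/negP => mP; have := congr1 (fun r : {poly K} => r`_(e m)) q0.
rewrite coef_sum coef0 (bigD1_seq m) ?mpoly.msupp_uniq //= coefZ coefXn eqxx mulr1.
rewrite big_seq_cond big1 ?addr0 => [|m' /andP[m'P m'm]].
  by move/eqP; rewrite mpoly.mcoeff_eq0 mP.
rewrite coefZ coefXn; case: eqP => [ee|_]; last by rewrite mulr0.
case/eqP: m'm; apply/mpoly.mnmP => i; apply/esym.
exact: (digits_inj (fun i => mB m i mP) (fun i => mB m' i m'P) ee).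
Qed.

Lemma meval_line n (P : mpoly.mpoly n K) (x y : 'I_n -> K) :
  exists q : {poly K}, forall t,
    q.[t] = mpoly.meval (fun i => x i + t * y i) P.
Proof.
exists (\sum_(m <- mpoly.msupp P)
  (mpoly.mcoeff m P)%:P * \prod_i ((x i)%:P + 'X * (y i)%:P) ^+ m i) => t.
rewrite mpoly.mevalE horner_sum; apply: eq_bigr => m _.
rewrite hornerM hornerC horner_prod; congr (_ * _); apply: eq_bigr => i _.
by rewrite !hornerE.
Qed.

Variable I : finType.
Implicit Types f g : (I -> K) -> K.

Definition polyfun f := exists P : mpoly.mpoly #|I| K,
  forall x, f x = mpoly.meval (fun j => x (enum_val j)) P.

Lemma polyfun_const c : polyfun (fun=> c).
Proof. by exists (mpoly.mpolyC _ c) => x; rewrite mpoly.mevalC. Qed.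

Lemma polyfun_coord i : polyfun (fun x => x i).
Proof.
exists (mpoly.mpolyX _ (mpoly.mnm1 (enum_rank i))) => x.
by rewrite mpoly.mevalXU enum_rankK.
Qed.

Lemma polyfunD f g : polyfun f -> polyfun g -> polyfun (fun x => f x + g x).
Proof. by move=> [P Pf] [Q Qg]; exists (P + Q) => x; rewrite mpoly.mevalD Pf Qg. Qed.

Lemma polyfunM f g : polyfun f -> polyfun g -> polyfun (fun x => f x * g x).
Proof. by move=> [P Pf] [Q Qg]; exists (P * Q) => x; rewrite mpoly.mevalM Pf Qg. Qed.

Lemma polyfun_sum (J : Type) (r : seq J) (F : J -> (I -> K) -> K) :
  (forall j, polyfun (F j)) -> polyfun (fun x => \sum_(j <- r) F j x).
Proof.
move=> Fp; elim: r => [|j r IH].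
  by rewrite (_ : (fun=> _) = fun=> 0); [exact: polyfun_const|apply/funext => x; rewrite big_nil].
rewrite (_ : (fun=> _) = fun x => F j x + \sum_(j <- r) F j x); first exact: polyfunD.
by apply/funext => x; rewrite big_cons.
Qed.

Lemma polyfun_prod (J : Type) (r : seq J) (F : J -> (I -> K) -> K) :
  (forall j, polyfun (F j)) -> polyfun (fun x => \prod_(j <- r) F j x).
Proof.
move=> Fp; elim: r => [|j r IH].
  by rewrite (_ : (fun=> _) = fun=> 1); [exact: polyfun_const|apply/funext => x; rewrite big_nil].
rewrite (_ : (fun=> _) = fun x => F j x * \prod_(j <- r) F j x); first exact: polyfunM.
by apply/funext => x; rewrite big_cons.
Qed.

Lemma polyfun_det n (A : (I -> K) -> 'M[K]_n) :
  (forall i j, polyfun (fun x => A x i j)) -> polyfun (fun x => \det (A x)).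
Proof.
move=> Ap; apply: polyfun_sum => s; apply: polyfunM; first exact: polyfun_const.
by apply: polyfun_prod => i; exact: Ap.
Qed.

Lemma polyfun_line f x y : polyfun f ->
  exists q : {poly K}, forall t, q.[t] = f (fun i => x i + t * y i).
Proof.
move=> [P Pf]; have [q Hq] := meval_line P (fun j => x (enum_val j)) (fun j => y (enum_val j)).
by exists q => t; rewrite Hq Pf.
Qed.

(** The complement of a single hypersurface is asked for: products of polynomials then give finite
    intersections, and the equation [f x = 0] gives the algebraic set of the final statement. *)
Definition generic (Q : (I -> K) -> Prop) := exists f,
  [/\ polyfun f, exists x, f x != 0 & forall x, f x != 0 -> Q x].

Lemma generic_all (Q : (I -> K) -> Prop) : (forall x, Q x) -> generic Q.
Proof.
move=> hQ; exists (fun=> 1); split=> //; first exact: polyfun_const.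
by exists (fun=> 0); exact: oner_neq0.
Qed.

(* On the line through [x] and [y] both polynomials are nonzero, hence so is
   their product. *)
Lemma generic_and Q1 Q2 : generic Q1 -> generic Q2 -> generic (fun x => Q1 x /\ Q2 x).
Proof.
move=> [f [fp [x fx] fQ]] [g [gp [y gy] gQ]].
exists (fun z => f z * g z); split; first exact: polyfunM; last first.
  by move=> z; rewrite mulf_eq0 negb_or => /andP[/fQ ? /gQ ?].
have [q1 q1E] := polyfun_line x (fun i => y i - x i) fp.
have [q2 q2E] := polyfun_line x (fun i => y i - x i) gp.
have nz : q1 * q2 != 0.
  rewrite mulf_neq0 //; [apply/eqP => q0; case/eqP: fx|apply/eqP => q0; case/eqP: gy].
    have := q1E 0; rewrite q0 horner0 => ->; congr f.
    by apply/funext => i; rewrite mul0r addr0.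
  have := q2E 1; rewrite q0 horner0 => ->; congr g.
  by apply/funext => i; rewrite mul1r addrC subrK.
have [t nt] : exists t, (q1 * q2).[t] != 0.
  apply: contrapT => /forallNP h; case/eqP: nz; apply: poly_fun_eq0 => t.
  by apply/eqP/negPn/negP/h.
by exists (fun i => x i + t * (y i - x i)); rewrite -q1E -q2E -hornerM.
Qed.

Lemma generic_forall (J : finType) (Q : J -> (I -> K) -> Prop) :
  (forall j, generic (Q j)) -> generic (fun x => forall j, Q j x).
Proof.
move=> hQ; suff [f [fp fx fQ]] : generic (fun x => forall j, j \in enum J -> Q j x).
  by exists f; split=> // x /fQ h j; apply: h; rewrite mem_enum.
elim: (enum J) => [|j s IH]; first exact: generic_all.
have [f [fp fx fQ]] := generic_and (hQ j) IH.
exists f; split=> // x /fQ[h1 h2] i; rewrite inE => /orP[/eqP ->//|]; exact: h2.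
Qed.

Lemma generic_sub (Q Q' : (I -> K) -> Prop) : (forall x, Q x -> Q' x) ->
  generic Q -> generic Q'.
Proof. by move=> sQ [f [fp fx fQ]]; exists f; split=> // x /fQ /sQ. Qed.

End PolynomialFunctions.

(** * Generic rank of systems of direction constraints *)

Section Directions.
Variable R : realType.
Implicit Types u v w : 'cV[R]_2.

Lemma ord2P (P : 'I_2 -> Prop) : P 0 -> P 1 -> forall i, P i.
Proof.
move=> P0 P1 [[|[|//]] i]; first by rewrite (_ : Ordinal i = 0) //; apply: val_inj.
by rewrite (_ : Ordinal i = 1) //; apply: val_inj.
Qed.

Lemma sum2 (V : zmodType) (F : 'I_2 -> V) : \sum_i F i = F 0 + F 1.
Proof. by rewrite !big_ord_recl big_ord0 addr0; congr (_ + F _); apply: val_inj. Qed.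

Lemma cV2P (T : Type) (a b : 'cV[T]_2) : a 0 0 = b 0 0 -> a 1 0 = b 1 0 -> a = b.
Proof. by move=> e0 e1; apply/matrixP => i j; rewrite (ord1 j); move: i; apply: ord2P. Qed.

Lemma mx2P (T : Type) (A B : 'M[T]_2) : A 0 0 = B 0 0 -> A 0 1 = B 0 1 ->
  A 1 0 = B 1 0 -> A 1 1 = B 1 1 -> A = B.
Proof. by move=> ? ? ? ?; apply/matrixP; apply: ord2P; apply: ord2P. Qed.

Lemma dotE u v : dot u v = u 0 0 * v 0 0 + u 1 0 * v 1 0.
Proof. by rewrite /dot sum2. Qed.

Lemma perp0E u : perp u 0 0 = - u 1 0.
Proof. by rewrite /perp !mxE sum2 !mxE /=; ring. Qed.

Lemma perp1E u : perp u 1 0 = u 0 0.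
Proof. by rewrite /perp !mxE sum2 !mxE /=; ring. Qed.

(** This is the determinant with columns [u] and [v], hence invariant under rotations. The codomain
    [R^o] is the scalars seen as a module, so that linearity in [v] can be registered. *)
Definition dperp u v : R^o := dot v (perp u).

Lemma dperpE u v : dperp u v = v 1 0 * u 0 0 - v 0 0 * u 1 0.
Proof. by rewrite /dperp dotE perp0E perp1E; ring. Qed.

Fact dperp_is_linear u : linear (dperp u).
Proof. by move=> a v w; rewrite !dperpE !mxE /GRing.scale /=; ring. Qed.
HB.instance Definition _ u := GRing.isLinear.Build R 'cV[R]_2 R^o *:%R (dperp u)
  (dperp_is_linear u).

Lemma dperpN u w : dperp u (- w) = - dperp u w.
Proof. exact: linearN. Qed.

Lemma dperp_parallel u w : u != 0 -> dperp u w = 0 -> exists t, w = t *: u.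
Proof.
move=> u0; rewrite dperpE => h.
have n0 : u 0 0 * u 0 0 + u 1 0 * u 1 0 != 0.
  apply: contra u0 => /eqP e; apply/eqP/cV2P; rewrite !mxE; nra.
exists ((w 0 0 * u 0 0 + w 1 0 * u 1 0) / (u 0 0 * u 0 0 + u 1 0 * u 1 0)).
have h0 := congr1 ( *%R (u 0 0)) h; have h1 := congr1 ( *%R (u 1 0)) h.
rewrite !mulr0 in h0 h1.
by apply: cV2P; rewrite !mxE mulrAC; apply: (canRL (mulfK n0)); lra.
Qed.

Variables (vT : vectType R) (X : {vspace vT}).

(** A linear form on [X] that vanishes on the kernel of [f] factors through the plane, where it is
    the determinant against some [u]. So the hyperplanes of Rado's theorem come from directions. *)
Lemma hyperplane_direction (f : 'Hom(vT, 'cV[R]_2)) (H : {vspace vT}) :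
  (X :&: lker f <= H)%VS -> (\dim X <= (\dim H).+1)%N -> (H <= X)%VS ->
  exists u, forall x, x \in X -> dperp u (f x) = 0 -> x \in H.
Proof.
move=> kH dH HX; have [XH|/subvPn[x0 x0X x0H]] := boolP (X <= H)%VS.
  by exists 0 => x /(subvP XH).
(* If [f] is nonzero on [H], any nonzero value there is the direction. Otherwise [f] maps [X] onto
   the line of [f x0], and a direction perpendicular to that line forces [f x = 0]. *)
have [fH0|fH0] := eqVneq (f @: H)%VS 0%VS; last first.
  have /memv_imgP[h hH eh] := memv_pick (f @: H).
  exists (vpick (f @: H)) => x xX /dperp_parallel; rewrite vpick0 => /(_ fH0)[t].
  rewrite eh -linearZ => e.
  have hX : t *: h \in X by apply/memvZ/(subvP HX).
  have xH : x - t *: h \in H.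
    apply: (subvP kH); rewrite memv_cap memv_ker linearB /= e subrr eqxx andbT.
    exact: memvB.
  have := memvD xH (memvZ t hH); by rewrite subrK.
have fx0 : f x0 != 0.
  by apply: contra x0H => f0; apply: (subvP kH); rewrite memv_cap x0X memv_ker.
have XE : (H + <[x0]>)%VS = X.
  apply/eqP; rewrite eqEdim subv_add HX -memvE x0X /=.
  have := dimv_sum_cap H <[x0]>; rewrite dim_vline.
  have /eqP -> : (H :&: <[x0]> == 0)%VS.
    rewrite -subv0; apply/subvP => y; rewrite memv_cap => /andP[yH /vlineP[c ey]].
    have [c0|c0] := eqVneq c 0; first by rewrite ey c0 scale0r mem0v.
    by case/negP: x0H; rewrite -(scalerK c0 x0) memvZ // -ey.
  rewrite dimv0; have -> : x0 != 0 by apply: contraNneq x0H => ->; rewrite mem0v.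
  lia.
exists (@perp R (f x0)); move=> x; rewrite -{1}XE => /memv_addP[h hH [_ /vlineP[c ->] ->]].
have fh : f h = 0 by apply/eqP; rewrite -memv0 -fH0 memv_img.
rewrite linearD linearZ /= fh add0r linearZ /= dperpE perp0E perp1E => /eqP.
rewrite scaler_eq0 => /orP[/eqP ->|/eqP e].
  by rewrite scale0r addr0.
by case/eqP: fx0; apply: cV2P; rewrite mxE; nra.
Qed.

Variables (E : finType) (f : E -> 'Hom(vT, 'cV[R]_2)).
Implicit Types (F : {set E}) (x : E * 'I_2 -> R).

Definition dirs x e : 'cV[R]_2 := \col_i x (e, i).

Definition sol F x : {vspace vT} :=
  (\bigcap_(e in F) lker (linfun (dperp (dirs x e)) \o f e))%VS.

Lemma memv_sol F x z :
  reflect (forall e, e \in F -> dperp (dirs x e) (f e z) = 0) (z \in sol F x).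
Proof.
rewrite memvE; apply: (iffP subv_bigcapP) => h e /h.
  by rewrite -memvE memv_ker comp_lfunE lfunE => /eqP.
by move=> h0; rewrite -memvE memv_ker comp_lfunE lfunE; apply/eqP.
Qed.

(** The system is restricted to a complement [N] of the solutions at [x0]. It is injective there at
    [x0], and injectivity survives outside a hypersurface. *)
Lemma sol_semicont (U : {vspace vT}) F x0 :
  generic (fun x => \dim (U :&: sol F x) <= \dim (U :&: sol F x0))%N.
Proof.
pose N := (U :\: (U :&: sol F x0))%VS.
pose b := vbasis N; have bN := vbasisP N.
pose D x : 'M[R]_(\dim N, #|E|) := \matrix_(i, j)
  (if enum_val j \in F then dperp (dirs x (enum_val j)) (f (enum_val j) b`_i) else 0).
have D0 x (c : 'rV_(\dim N)) : (c *m D x == 0) = (\sum_i c 0 i *: b`_i \in sol F x).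
  apply/eqP/memv_sol => [/matrixP h e eF|h].
    have := h 0 (enum_rank e); rewrite !mxE => he; rewrite -[RHS]he !linear_sum /=; apply: eq_bigr => i _.
    by rewrite mxE enum_rankK eF !linearZ.
  apply/matrixP => i j; rewrite (ord1 i) !mxE.
  case: (boolP (enum_val j \in F)) => [jF|jF]; last first.
    by rewrite big1 // => a _; rewrite mxE (negPf jF) mulr0.
  rewrite -[RHS](h _ jF) !linear_sum /=; apply: eq_bigr => a _.
  by rewrite mxE jF !linearZ.
have NU : (N <= U)%VS by exact: diffvSl.
have /row_freeP[B DB] : row_free (D x0).
  rewrite -kermx_eq0; apply/rowV0P => c /sub_kermxP/eqP; rewrite D0 => cs.
  have : \sum_i c 0 i *: b`_i \in (N :&: (U :&: sol F x0))%VS.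
    have cN : \sum_i c 0 i *: b`_i \in N.
      by apply: rpred_sum => i _; rewrite memvZ // (vbasis_mem (mem_nth _ _)) ?size_tuple.
    by rewrite !memv_cap cN cs (subvP NU).
  rewrite capv_diff memv0 => /eqP e; apply/rowP => i; rewrite mxE.
  have /freeP := basis_free bN; exact.
(* Keeping the right inverse [B] of [D x0] fixed makes this determinant polynomial in [x], with
   value 1 at [x0]. Where it is nonzero, [N] contains no nonzero solution. *)
exists (fun x => \det (D x *m B)); split.
- apply: polyfun_det => i j.
  rewrite (_ : (fun x => _) = fun x => \sum_a D x i a * B a j); last first.
    by apply/funext => x; rewrite mxE.
  apply: polyfun_sum => a; apply: polyfunM; last exact: polyfun_const.
  case: (boolP (enum_val a \in F)) => aF; last first.
    rewrite (_ : (fun x => _) = fun=> 0); first exact: polyfun_const.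
    by apply/funext => x; rewrite mxE (negPf aF).
  pose w := f (enum_val a) b`_i.
  rewrite (_ : (fun x => _) =
      fun x => w 1 0 * x (enum_val a, 0) + (- w 0 0) * x (enum_val a, 1)).
    by apply: polyfunD; apply: polyfunM; (exact: polyfun_const || exact: polyfun_coord).
  by apply/funext => x; rewrite mxE aF dperpE !mxE mulNr.
- by exists x0; rewrite DB det1 oner_neq0.
move=> x dx.
have NS : (N :&: (U :&: sol F x) = 0)%VS.
  apply/eqP; rewrite -subv0; apply/subvP => v; rewrite !memv_cap => /and3P[vN vU vs].
  have vE := coord_basis bN vN.
  pose c : 'rV_(\dim N) := \row_i coord b i v.
  have : c *m D x == 0.
    by rewrite D0 (eq_bigr (fun i => coord b i v *: b`_i)) -?vE // => i _; rewrite mxE.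
  move=> /eqP c0; have /eqP c00 : c == 0.
    have uD : D x *m B \in unitmx by rewrite unitmxE unitfE.
    by rewrite -[c](mulmxK uD) mulmxA c0 !mul0mx.
  rewrite memv0 vE big1 // => i _; have /rowP/(_ i) := c00; rewrite !mxE => ->.
  by rewrite scale0r.
have := dimv_sum_cap N (U :&: sol F x); rewrite NS dimv0.
have : (N + (U :&: sol F x) <= U)%VS by rewrite subv_add NU capvSl.
move=> /dimvS; have := dimv_cap_compl U (U :&: sol F x0); rewrite -/N.
by rewrite (capv_idPr (capvSl _ _)); lia.
Qed.

End Directions.

Section GenericRank.
Variables (R : realType) (vT : vectType R) (X : {vspace vT}) (E : finType).
Variable f : E -> 'Hom(vT, 'cV[R]_2).
Implicit Types (F : {set E}) (x : E * 'I_2 -> R).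

Definition kers e : {vspace vT} := (X :&: lker (f e))%VS.

Lemma memv_kers F z :
  reflect (z \in X /\ forall e, e \in F -> f e z = 0) (z \in caps X kers F).
Proof.
rewrite memv_caps; apply: (iffP andP) => -[zX h]; split=> //.
  move=> e eF; apply/eqP; have := forall_inP h e eF.
  by rewrite memv_cap memv_ker => /andP[].
by apply/forall_inP => e /h e0; rewrite memv_cap memv_ker zX e0 /=.
Qed.

Lemma kers_sub_sol F x : (caps X kers F <= X :&: sol f F x)%VS.
Proof.
apply/subvP => z /memv_kers[zX h]; rewrite memv_cap zX.
by apply/memv_sol => e /h ->; rewrite linear0.
Qed.

Lemma kersS F1 F2 : F1 \subset F2 -> (caps X kers F2 <= caps X kers F1)%VS.
Proof.
move=> /fintype.subsetP sF; apply/subvP => z /memv_kers[zX h].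
by apply/memv_kers; split=> // e /sF /h.
Qed.

Lemma dim_sol F x : (\dim X <= #|F| + \dim (X :&: sol f F x))%N.
Proof.
elim: {F}#|F| {-2}F (erefl #|F|) => [|n IH] F cF.
  have -> : sol f F x = fullv.
    by rewrite /sol (cards0_eq cF) big_pred0 // => e; rewrite inE.
  by rewrite capvf cF.
have [e eF] : exists e, e \in F by apply/card_gt0P; rewrite cF.
have cFe : #|F :\ e| = n by move: cF; rewrite (cardsD1 e) eF => -[].
have := IH _ cFe; rewrite cFe cF; pose k := (linfun (dperp (dirs x e)) \o f e)%VF.
have -> : (X :&: sol f F x)%VS = (X :&: sol f (F :\ e) x :&: lker k)%VS.
  apply/vspaceP => z; rewrite !memv_cap -andbA; congr andb.
  apply/memv_sol/andP => [h|[/memv_sol h]].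
    split; first by apply/memv_sol => e' /setD1P[_ /h].
    by rewrite memv_ker comp_lfunE lfunE /= h.
  rewrite memv_ker comp_lfunE lfunE => /eqP he e' e'F.
  by have [->//|ne] := eqVneq e' e; apply: h; rewrite !inE ne.
have := limg_ker_dim k (X :&: sol f (F :\ e) x).
have : (\dim (k @: (X :&: sol f (F :\ e) x)) <= 1)%N.
  by apply: leq_trans (dimvS (subvf _)) _; rewrite dimvf.
by lia.
Qed.

Lemma hyperplane_directions F (H : E -> {vspace vT}) :
  (forall e, e \in F -> (kers e <= H e <= X)%VS) ->
  (forall e, e \in F -> (\dim X <= (\dim (H e)).+1)%N) ->
  exists x, (X :&: sol f F x <= caps X H F)%VS.
Proof.
move=> kH dH; have /choice[u hu] : forall e, exists u, e \in F ->
    forall z, z \in X -> dperp u (f e z) = 0 -> z \in H e.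
  move=> e; case: (boolP (e \in F)) => eF; last by exists 0.
  have /andP[kHe HX] := kH _ eF.
  by have [u hu] := hyperplane_direction kHe (dH _ eF) HX; exists u.
exists (fun ei => u ei.1 ei.2 0); apply/subvP => z.
rewrite memv_cap memv_caps => /andP[zX /memv_sol zs]; rewrite zX.
apply/forall_inP => e eF; apply: hu => //; rewrite -[RHS](zs e eF).
by congr (dperp _ _); apply/matrixP => i j; rewrite mxE (ord1 j).
Qed.

Theorem generic_rank F : rado X F kers ->
  generic (fun x => #|F| + \dim (X :&: sol f F x) <= \dim X)%N.
Proof.
move=> rF; have [H [kH dH rH]] := dual_rado (fun e => capvSl X (lker (f e))) rF.
have [x0 sx0] := hyperplane_directions (fun e (_ : e \in F) => kH e) dH.
apply: generic_sub (sol_semicont f X F x0) => x le; apply: leq_trans (rH F (subxx _)).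
by rewrite leq_add2l; apply: leq_trans le (dimvS sx0).
Qed.

(** The subspace [K] joins the family of Rado's theorem under the index [None]. The hyperplane [H]
    around it is fixed before the directions vary, so semicontinuity applies inside [H]. *)
Theorem generic_rank1 (K : {vspace vT}) : (K <= X)%VS ->
  (forall F, (#|F| + \dim (caps X kers F) <= \dim X)%N) ->
  (forall F, (#|F|.+1 + \dim (caps X kers F :&: K) <= \dim X)%N) ->
  exists H, [/\ (K <= H)%VS, (\dim X <= (\dim (X :&: H)).+1)%N &
    generic (fun x => #|E|.+1 + \dim (X :&: sol f [set: E]%SET x :&: H) <= \dim X)%N].
Proof.
move=> KX rf rK; pose U o := if o is Some e then kers e else K.
have capsE (G : {set option E}) : caps X U G =
    if None \in G then (caps X kers (Some @^-1: G) :&: K)%VS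
    else caps X kers (Some @^-1: G).
  apply/vspaceP => z; rewrite memv_caps.
  have -> : (z \in if None \in G then (caps X kers (Some @^-1: G) :&: K)%VS
    else caps X kers (Some @^-1: G)) =
    (z \in caps X kers (Some @^-1: G)) && ((None \in G) ==> (z \in K)).
    by case: (None \in G); rewrite ?memv_cap ?andbT.
  rewrite memv_caps -andbA; congr andb; apply/forall_inP/andP.
    move=> h; split; last by apply/implyP => /h.
    by apply/forall_inP => e; rewrite inE => /h.
  move=> [/forall_inP h /implyP h'] [e eG|/h' //]; by apply: h; rewrite inE.
have Sinj : injective (@Some E) by move=> a b [].
have cardE (G : {set option E}) : #|G| = ((None \in G) + #|Some @^-1: G|)%N.
  rewrite (cardsD1 None); congr addn; rewrite -(card_imset _ Sinj).
  apply: eq_card => -[e|]; rewrite !inE /=.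
    by rewrite (mem_imset _ _ Sinj) inE.
  by apply/esym/imsetP => -[].
have [|G _|H [UH dH rH]] := @dual_rado _ _ _ X [set: option E]%SET U.
- by case=> [e|] //; exact: capvSl.
- by rewrite capsE cardE; case: (None \in G); [exact: rK | exact: rf].
have [e _|e _|x0 sx0] := @hyperplane_directions [set: E]%SET (H \o Some).
- exact: (UH (Some e)).
- exact: dH.
have /andP[KH HX] := UH None.
exists (H None); split=> //; first by rewrite (capv_idPr HX) dH.
have dsetT : #|[set: option E]%SET| = #|E|.+1 by rewrite cardsT card_option.
apply: generic_sub (sol_semicont f (H None) [set: E]%SET x0) => x le.
apply: leq_trans (rH [set: option E]%SET (subxx _)).
rewrite dsetT leq_add2l capvC capvA (capv_idPl HX); apply: leq_trans le (dimvS _).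
apply/subvP => z; rewrite memv_cap => /andP[zH zs].
have zX := subvP HX z zH; rewrite memv_caps zX.
apply/forall_inP => -[e|] _ //.
have : z \in caps X (H \o Some) [set: E]%SET by apply: (subvP sx0); rewrite memv_cap zX.
by rewrite memv_caps => /andP[_ /forall_inP]; apply.
Qed.

End GenericRank.

(** * The lattice and its representations *)

Section Lattice.
Variables (R : realType) (k : crystal).
Implicit Types (M : 'M[R]_2) (g h : Gam k) (q : 'cV[R]_2).

Lemma det2E (K : comNzRingType) (A : 'M[K]_2) : \det A = A 0 0 * A 1 1 - A 0 1 * A 1 0.
Proof.
rewrite (expand_det_row _ 0) !big_ord_recl big_ord0 /cofactor !det_mx11 !mxE /=.
have -> : lift 0 0 = 1 :> 'I_2 by apply: val_inj.
have -> : lift 1 0 = 0 :> 'I_2 by apply: val_inj.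
by rewrite addr0 /= expr0 expr1 mul1r mulN1r mulrN.
Qed.

Lemma mulmx2E (K : pzSemiRingType) m p (A : 'M[K]_(m, 2)) (B : 'M[K]_(2, p)) i j :
  (A *m B) i j = A i 0 * B 0 j + A i 1 * B 1 j.
Proof. by rewrite !mxE !big_ord_recl big_ord0 addr0; congr (_ + A _ _ * B _ _); apply: val_inj. Qed.

Lemma lattice_fixed_free (s : 'I_(order_of k).-1.+1) : s != 0 ->
  \det (1%:M - lattice_mx k ^+ s) != 0.
Proof.
by case: k s => -[[|[|[|[|[|[|n]]]]]] //= i] // _;
  rewrite det2E !exprS expr0 ?mulr1 -?mulmxE ?mulmx2 !mxE.
Qed.

(** The triple angle formula gives [(c + 1) * (2 * c - 1) ^+ 2 = 0] for the cosine [c], and [c]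
    exceeds -1 by monotonicity. *)
Lemma cos_pi_third : cos (pi / 3%:R : R) = 2^-1.
Proof.
have c3 : cos (pi / 3%:R *+ 3 : R) = -1.
  by rewrite -mulr_natr divfK ?pnatr_eq0 // cospi.
have cN1 : cos (pi / 3%:R : R) > -1.
  rewrite -(@cospi R) ltr_cos ?in_itv /= ?pi_ge0 ?lexx //; have := @pi_gt0 R; lra.
rewrite mulrS cosD cos_mulr2n sin_mulr2n in c3.
have s2 := sin2cos2 (pi / 3%:R : R).
set c := cos (pi / 3%:R) in c3 cN1 s2 *; set s := sin _ in c3 s2.
have : (c + 1) * (2 * c - 1) ^+ 2 = 0.
  have sE : s * (c * s *+ 2) = 2 * c * (1 - c ^+ 2) by rewrite -s2; ring.
  have cE : c * (c ^+ 2 *+ 2 - 1) = 2 * c ^+ 3 - c by ring.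
  rewrite sE cE in c3; have -> : (c + 1) * (2 * c - 1) ^+ 2 =
    (2 * c ^+ 3 - c) - 2 * c * (1 - c ^+ 2) + 1 by ring.
  by rewrite c3; ring.
by move/eqP; rewrite mulf_eq0 sqrf_eq0 => /orP[/eqP|/eqP]; lra.
Qed.

Let c := cos (2 * pi / (order_of k)%:R : R).
Let s := sin (2 * pi / (order_of k)%:R : R).

Let rotRE : rotR R k = mx2 c (- s) s c.
Proof. by []. Qed.

Let c2s2 : c ^+ 2 + s ^+ 2 = 1.
Proof. exact: cos2Dsin2. Qed.

(** Both matrices have determinant 1, so equal traces mean equal characteristic polynomials; this
    links the rotation to its integral form. *)
Lemma rotR_trace : 2 * c = (\tr (lattice_mx k))%:~R.
Proof.
have trE (a b a' b' : int) : \tr (mx2 a b a' b') = a + b'.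
  by rewrite /mxtrace sum2 !mxE.
rewrite /c; case: k => /=; rewrite ?trE ?mxtrace1.
- by rewrite (_ : 2 * pi / _ = pi *+ 2); [rewrite cos2pi mulr1|field].
- by rewrite mulrAC divff ?mul1r ?cospi ?pnatr_eq0 //; lra.
- rewrite (_ : 2 * pi / _ = (pi / 3%:R) *+ 2); last by field.
  by rewrite cos_mulr2n cos_pi_third; lra.
- by rewrite (_ : 2 * pi / _ = pi / 2); [rewrite cos_pihalf mulr0|field].
- by rewrite (_ : 2 * pi / _ = pi / 3%:R); [rewrite cos_pi_third; lra|field].
Qed.

Definition latR : 'M[R]_2 := map_mx intr (lattice_mx k).

(** The columns of [M] are the images of the lattice basis; the equation is what the relation
    [r_transl] between the generating rotation and the translations becomes in the plane. *)
Definition intertwines M := M *m latR = rotR R k *m M.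

(** For orders 3, 4 and 6 the lattice matrix is a companion matrix, so a vector and its rotation
    serve as columns, independent because the sine is nonzero. For orders 1 and 2 both matrices are
    the same scalar. *)
Lemma intertwiner_exists : exists2 M, intertwines M & M \in unitmx.
Proof.
have tr := rotR_trace; rewrite /intertwines /latR rotRE.
have [|k12] := pselect (k = P3 \/ k = P4 \/ k = P6).
  move=> k346; have latE : lattice_mx k = mx2 0 (-1) 1 (\tr (lattice_mx k)).
    by move: k346; case=> [->|[->|->]]; apply: mx2P; rewrite /mxtrace ?sum2 !mxE.
  have s0 : s != 0.
    apply/eqP => s0; have := c2s2; rewrite s0.
    move: tr; case: k346 => [->|[->|->]]; rewrite /mxtrace sum2 !mxE /=; nra.
  exists (mx2 1 c 0 s); last by rewrite unitmxE unitfE det2E !mxE /= mul1r mulr0 subr0.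
  rewrite latE; apply: mx2P; rewrite !mulmx2E !mxE /= -?tr ?rmorphN ?rmorph1 ?rmorph0;
    have := c2s2; lra.
exists 1%:M; last exact: unitmx1.
rewrite mul1mx mulmx1; have latE : map_mx intr (lattice_mx k) = c%:M.
  move: tr k12; case: k => //= tr k12; try by case: k12; auto.
    rewrite map_scalar_mx rmorph1; congr _%:M; move: tr; rewrite mxtrace1 /=; lra.
  by move: tr; rewrite /mxtrace sum2 !mxE /= => tr; apply: mx2P; rewrite !mxE /=; lra.
have c1 : c ^+ 2 = 1.
  move: tr; case: (k) k12 => /= k12; try by case: k12; auto.
    by rewrite mxtrace1; nra.
  by rewrite /mxtrace sum2 !mxE /=; nra.
have s0 : s = 0.
  by apply/eqP; rewrite -sqrf_eq0; apply/eqP; have := c2s2; rewrite c1; lra.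
by rewrite latE s0; apply: mx2P; rewrite !mxE /= ?oppr0.
Qed.

End Lattice.

(** * The affine action attached to a lattice matrix *)

Section AffineAction.
Variables (R : realType) (k : crystal).
Local Notation ord := 'I_(order_of k).-1.+1.
Implicit Types (M : 'M[R]_2) (g h : Gam k) (q : 'cV[R]_2) (t : 'cV[int]_2) (s : ord).
Local Notation rotR := (rotR R k).
Local Notation latR := (latR R k).

Lemma intertwinesX M n : intertwines k M -> M *m latR ^+ n = rotR ^+ n *m M.
Proof.
move=> MA; elim: n => [|n IH]; first by rewrite !expr0 mulmx1 mul1mx.
by rewrite !exprS -!mulmxE mulmxA MA -mulmxA IH mulmxA.
Qed.

Lemma latRX n : latR ^+ n = map_mx intr (lattice_mx k ^+ n).
Proof. by rewrite rmorphXn. Qed.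

(** Conjugation by an invertible intertwiner carries the finite order over from the integer matrix,
    without trigonometry. *)
Lemma rotR_order : rotR ^+ (order_of k).-1.+1 = 1.
Proof.
have [M MA uM] := intertwiner_exists R k.
have := intertwinesX (order_of k).-1.+1 MA.
rewrite latRX lattice_mx_order rmorph1 mulmx1 => e.
by rewrite -[LHS](mulmxK uM) -e mulmxV.
Qed.

Lemma rotRD s s' : rotR ^+ (s + s')%R = rotR ^+ s *m rotR ^+ s'.
Proof. by rewrite mulmxE -exprD /= expr_mod // rotR_order. Qed.

Lemma rotR0 : rotR ^+ (0 : ord)%R = 1%:M.
Proof. by rewrite expr0. Qed.

Lemma rotR_inZp n : rotR ^+ (inZp n : ord) = rotR ^+ n.
Proof. by rewrite expr_mod // rotR_order. Qed.

Lemma lattice_inZp n : lattice_mx k ^+ (inZp n : ord) = lattice_mx k ^+ n.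
Proof. by rewrite expr_mod // lattice_mx_order. Qed.

Lemma rotR_fixed_free s : s != 0 -> 1%:M - rotR ^+ s \in unitmx.
Proof.
move=> s0; have [M MA uM] := intertwiner_exists R k.
have : (1%:M - rotR ^+ s) *m M \in unitmx.
  rewrite mulmxBl mul1mx -(intertwinesX s MA) -[X in X - _]mulmx1 -mulmxBr.
  rewrite unitmx_mul uM latRX -(map_mx1 intr) -map_mxB unitmxE det_map_mx unitfE.
  by rewrite intr_eq0; exact: lattice_fixed_free.
by rewrite unitmx_mul => /andP[].
Qed.

Lemma rotR_eq1 s : rotR ^+ s = 1%:M -> s = 0.
Proof.
move=> e; apply/eqP/negPn/negP => /rotR_fixed_free.
by rewrite e subrr unitmxE det0 unitr0.
Qed.

Lemma det_rotR n : \det (rotR ^+ n) = 1.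
Proof.
elim: n => [|n IH]; first by rewrite expr0 det1.
by rewrite exprS -mulmxE det_mulmx IH mulr1 det2E !mxE /= mulNr opprK -!expr2 cos2Dsin2.
Qed.

Lemma rotR_orth n : (rotR ^+ n)^T *m rotR ^+ n = 1%:M.
Proof.
elim: n => [|n IH]; first by rewrite expr0 trmx1 mulmx1.
rewrite exprS -mulmxE trmx_mul mulmxA -[_ *m _ *m rotR]mulmxA.
have -> : rotR^T *m rotR = 1%:M by
  have := cos2Dsin2 (2 * pi / (order_of k)%:R : R) => e;
  apply: mx2P; rewrite mulmx2E !mxE /=; lra.
by rewrite mulmx1.
Qed.

Lemma dperp_rotR n q q' : dperp (rotR ^+ n *m q) (rotR ^+ n *m q') = dperp q q'.
Proof.
have dE (A : 'M[R]_2) : dperp (A *m q) (A *m q') = \det A * dperp q q'.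
  by rewrite det2E !dperpE !mulmx2E; ring.
by rewrite dE det_rotR mul1r.
Qed.

Lemma rot_partE g : rot_part R g = rotR ^+ g.2.
Proof.
have [e|nP1] := pselect (k = P1); last by rewrite /rot_part; case: (k) nP1 g.
have -> : rot_part R g = 1%:M by rewrite /rot_part; case: (k) e g.
suff -> : g.2 = 0 by rewrite rotR0.
by apply: val_inj; case: g => t [n] /=; rewrite e /=; case: n.
Qed.

Definition toR t : 'cV[R]_2 := map_mx intr t.

(** The normal form of a representation with its rotation center at the origin. It is linear in [M]
    and [q] jointly, so that normalized realizations form a vector space. *)
Definition aff M g q : 'cV[R]_2 := M *m toR g.1 + rotR ^+ g.2 *m q.

Lemma aff1 M q : aff M 1%g q = q.
Proof. by rewrite /aff /toR /= map_mx0 mulmx0 add0r rotR0 mul1mx. Qed.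

Lemma affM M g h q : intertwines k M -> aff M (g * h)%g q = aff M g (aff M h q).
Proof.
move=> MA; rewrite /aff /= rotRD /toR map_mxD map_mxM (mulmxDr M) -latRX.
by rewrite (mulmxA M) (intertwinesX _ MA) mulmxDr !mulmxA addrA.
Qed.

Lemma affVK M g q : intertwines k M -> aff M g^-1%g (aff M g q) = q.
Proof. by move=> MA; rewrite -affM // mulVg aff1. Qed.

Lemma affB M M' g q q' : aff M g q - aff M' g q' = aff (M - M') g (q - q').
Proof. by rewrite /aff mulmxBl mulmxBr addrACA opprD. Qed.

Lemma aff_linear a M M' g q q' :
  aff (a *: M + M') g (a *: q + q') = a *: aff M g q + aff M' g q'.
Proof.
by rewrite /aff mulmxDl mulmxDr scalerDr -!scalemxAl -!scalemxAr addrACA.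
Qed.

Lemma eapp_inj (x y : euc R) : (forall q, eapp x q = eapp y q) -> x = y.
Proof.
move=> e; have et : etrans x = etrans y.
  by have := e 0; rewrite /eapp !mulmx0 !addr0.
apply: euc_eq => //; apply/matrixP => i j.
have := e (delta_mx j 0); rewrite /eapp et => /addrI /matrixP/(_ i 0).
by rewrite -!colE !mxE.
Qed.

Lemma eappM (x y : euc R) q : eapp (x * y)%g q = eapp x (eapp y q).
Proof. by rewrite /eapp /= mulmxDr mulmxA addrA. Qed.

Lemma lattice_ind (P : 'cV[int]_2 -> Prop) : (forall a b, P a -> P b -> P (a - b)) ->
  (forall i, P (delta_mx i 0)) -> forall t, P t.
Proof.
move=> PB Pd t.
have P0 : P 0 by rewrite -(subrr (delta_mx 0 0)); exact: PB.
have PN a : P a -> P (- a) by rewrite -sub0r; exact: PB.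
have PD a b : P a -> P b -> P (a + b) by move=> ? ?; rewrite -[b]opprK; auto.
have Pn a n : P a -> P (a *+ n).
  by move=> ?; elim: n => [|n IH]; rewrite ?mulr0n ?mulrS; auto.
have Pz a z : P a -> P (a *~ z) by case: z => n ?; [|apply: PN]; exact: Pn.
have -> : t = delta_mx 0 0 *~ t 0 0 + delta_mx 1 0 *~ t 1 0.
  have E (i j : 'I_2) z : (delta_mx i 0 *~ z : 'cV[int]_2) j 0 = (j == i)%:R * z.
    by rewrite -scaler_int mxE mxE eqxx andbT intz mulrC.
  by apply: cV2P; rewrite mxE !E /= ?mul1r ?mul0r ?addr0 ?add0r.
by apply: PD; apply: Pz.
Qed.

Variable Phi : Gam k -> euc R.
Hypothesis Phi_hom : is_hom Phi.

Lemma hom1 : Phi 1%g = 1%g.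
Proof.
have := Phi_hom 1%g 1%g; rewrite mulg1 => e; apply: (mulgI (Phi 1%g)).
by rewrite mulg1 -e.
Qed.

Lemma homV g : Phi g^-1%g = (Phi g)^-1%g.
Proof. by apply: (mulgI (Phi g)); rewrite -Phi_hom !mulgV hom1. Qed.

Definition transl t : Gam k := (t, 0).

Lemma Gam_eq g h : g.1 = h.1 -> g.2 = h.2 -> g = h.
Proof. by case: g h => ? ? [? ?] /= -> ->. Qed.

Lemma Gam_mul1E g h : (g * h)%g.1 = g.1 + lattice_mx k ^+ (g.2 : nat) *m h.1.
Proof. by []. Qed.

Lemma Gam_mul2E g h : (g * h)%g.2 = g.2 + h.2.
Proof. by []. Qed.

Lemma translD t t' : transl (t + t') = (transl t * transl t')%g.
Proof. by apply: Gam_eq; rewrite ?Gam_mul1E ?Gam_mul2E /= ?expr0 ?mul1mx ?addr0. Qed.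

Lemma translN t : transl (- t) = (transl t)^-1%g.
Proof.
apply: (mulgI (transl t)); rewrite mulgV -translD subrr //.
Qed.

Lemma Gam_split g : g = (transl g.1 * (0, g.2))%g.
Proof. by apply: Gam_eq; rewrite ?Gam_mul1E ?Gam_mul2E /= ?mulmx0 ?addr0 ?add0r. Qed.

Lemma r_X n : (r_ k ^+ n)%g = (0, inZp n).
Proof.
elim: n => [|n IH]; first by apply: Gam_eq => //; apply: val_inj; rewrite /= mod0n.
rewrite expgS IH; apply: Gam_eq; rewrite ?Gam_mul1E ?Gam_mul2E /= ?mulmx0 ?addr0 //.
by apply: val_inj; rewrite /= modnDm add1n.
Qed.

Lemma rot_r_X s : (0, s) = (r_ k ^+ s)%g.
Proof. by rewrite r_X valZpK. Qed.

Lemma r_transl t : (r_ k * transl t)%g = (transl (lattice_mx k *m t) * r_ k)%g.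
Proof.
apply: Gam_eq; last by rewrite !Gam_mul2E addrC.
by rewrite !Gam_mul1E lattice_inZp expr1 mulmx0 addr0 add0r.
Qed.

Definition colM : 'M[R]_2 := \matrix_(i, j) etrans (Phi (t_ k j)) i 0.

Lemma etransM x y : etrans (x * y : euc R)%g = etrans x + erot x *m etrans y.
Proof. by []. Qed.

Lemma erotM x y : erot (x * y : euc R)%g = erot x *m erot y.
Proof. by []. Qed.

Lemma erotV (x : euc R) : erot (x^-1)%g = (erot x)^T.
Proof. by []. Qed.

Lemma etransV (x : euc R) : etrans (x^-1)%g = - ((erot x)^T *m etrans x).
Proof. by []. Qed.

Lemma erotX x n : erot (x ^+ n : euc R)%g = erot x ^+ n.
Proof.
elim: n => [|n IH]; first by rewrite expg0 expr0.
by rewrite expgS erotM IH exprS mulmxE.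
Qed.

Hypothesis Phi_transl : forall i, erot (Phi (t_ k i)) = 1%:M.

Lemma erot_transl t : erot (Phi (transl t)) = 1%:M.
Proof.
elim/lattice_ind: t => [a b ea eb|i]; last exact: Phi_transl.
by rewrite translD translN Phi_hom homV erotM ea mul1mx erotV eb trmx1.
Qed.

Lemma etrans_transl t : etrans (Phi (transl t)) = colM *m toR t.
Proof.
elim/lattice_ind: t => [a b ea eb|i]; last first.
  rewrite /toR map_delta_mx -colE; apply/matrixP => a b.
  by rewrite !mxE (ord1 b).
rewrite translD translN Phi_hom homV etransM ea erot_transl mul1mx.
rewrite /toR map_mxD map_mxN mulmxDr mulmxN; congr (_ + _).
by rewrite etransV erot_transl trmx1 mul1mx eb.
Qed.

Lemma erot_Gam g : erot (Phi g) = erot (Phi (r_ k)) ^+ g.2.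
Proof.
rewrite [in LHS](Gam_split g) Phi_hom erotM erot_transl mul1mx rot_r_X.
by elim: (val g.2) => [|n IH]; rewrite ?expg0 ?hom1 ?expr0 // expgS Phi_hom erotM IH exprS.
Qed.

Lemma colM_intertwines : colM *m latR = erot (Phi (r_ k)) *m colM.
Proof.
suff E t : colM *m latR *m toR t = erot (Phi (r_ k)) *m colM *m toR t.
  apply/matrixP => i j; have := E (delta_mx j 0).
  by rewrite /toR map_delta_mx -!colE => /matrixP/(_ i 0); rewrite !mxE.
have /(congr1 (@etrans R)) := congr1 Phi (r_transl t).
rewrite !Phi_hom !etransM !erot_transl mul1mx [RHS]addrC => /addrI.
by rewrite !etrans_transl -!mulmxA => ->; rewrite -map_mxM.
Qed.

End AffineAction.

(** * Discrete faithful representations *)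

Section DiscreteReps.
Variables (R : realType) (k : crystal).
Implicit Types (M : 'M[R]_2) (g h : Gam k) (t : 'cV[int]_2) (x : euc R).
Local Notation rotR := (rotR R k).
Local Notation latR := (latR R k).

(** Cells of width [d] cut the bounded box into finitely many pieces, and one more term than pieces
    puts two terms into the same cell. *)
Lemma pigeonhole (J : finType) (u : J -> nat -> R) (B d : R) : 0 < d ->
  (forall c n, `|u c n| <= B) ->
  exists i j, i != j /\ forall c, `|u c i - u c j| < d.
Proof.
move=> d0 uB; pose a c n := (u c n + B) / d; pose N := Num.truncn ((B + B) / d).
have a0 c n : 0 <= a c n.
  by rewrite divr_ge0 ?(ltW d0) //; have := uB c n; rewrite ler_norml => /andP[? ?]; lra.
have aN c n : (Num.truncn (a c n) < N.+1)%N.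
  rewrite ltnS le_truncn // ler_pM2r ?invr_gt0 // lerD2r.
  by have := uB c n; rewrite ler_norml => /andP[].
pose F (i : 'I_(#|{ffun J -> 'I_N.+1}|.+1)) := [ffun c => inord (Num.truncn (a c i)) : 'I_N.+1].
have /injectivePn[i [j ij Fij]] : ~~ injectiveb F.
  by apply/negP => /injectiveP /leq_card; rewrite card_ord ltnn.
exists (i : nat), (j : nat); split=> // c.
have /ffunP/(_ c) := Fij; rewrite !ffunE => /(congr1 val); rewrite /= !inordK // => e.
have /andP[i1 i2] := truncn_itv (a0 c i); have /andP[j1 j2] := truncn_itv (a0 c j).
rewrite e in i1 i2; have : `|a c i - a c j| < 1.
  move: i1 i2 j1 j2; rewrite -natr1; move: (a c i) (a c j) ((Num.truncn _)%:R : R) => x y n.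
  by move=> *; rewrite ltr_norml; apply/andP; split; lra.
rewrite /a -mulrBl normrM normfV (gtr0_norm d0) ltr_pdivrMr // mul1r.
by rewrite (_ : u c i + B - _ = u c i - u c j) //; ring.
Qed.

Lemma orth_entry (A : 'M[R]_2) i j : A^T *m A = 1%:M -> `|A i j| <= 1.
Proof.
move=> /matrixP/(_ j j); rewrite mulmx2E !mxE eqxx /= => e.
rewrite -(@expr_le1 _ 2) // real_normK ?num_real //.
by move: i e; apply: ord2P => e; have := sqr_ge0 (A 0 j); have := sqr_ge0 (A 1 j); lra.
Qed.

Lemma rotation_entries (r : 'M[R]_2) : r^T *m r = 1%:M -> \det r = 1 ->
  [/\ r 1 1 = r 0 0, r 0 1 = - r 1 0 & r 0 0 ^+ 2 + r 1 0 ^+ 2 = 1].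
Proof.
move=> ort dr.
have o00 : r 0 0 ^+ 2 + r 1 0 ^+ 2 = 1.
  by have /matrixP/(_ 0 0) := ort; rewrite mulmx2E !mxE /= -!expr2.
have o11 : r 0 1 ^+ 2 + r 1 1 ^+ 2 = 1.
  by have /matrixP/(_ 1 1) := ort; rewrite mulmx2E !mxE /= -!expr2.
rewrite det2E in dr.
have e1 : r 1 1 = r 0 0.
  have : (r 0 0 - r 1 1) ^+ 2 + (r 0 1 + r 1 0) ^+ 2 = 0.
    have -> : (r 0 0 - r 1 1) ^+ 2 + (r 0 1 + r 1 0) ^+ 2 =
      (r 0 0 ^+ 2 + r 1 0 ^+ 2) + (r 0 1 ^+ 2 + r 1 1 ^+ 2)
      - 2 * (r 0 0 * r 1 1 - r 0 1 * r 1 0) by ring.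
    by rewrite o00 o11 dr; ring.
  by have := sqr_ge0 (r 0 1 + r 1 0); have := sqr_ge0 (r 0 0 - r 1 1) => ? ? ?;
    apply/eqP; rewrite eq_sym -subr_eq0 -sqrf_eq0; apply/eqP; lra.
have e2 : r 0 1 = - r 1 0.
  apply/eqP; rewrite -addr_eq0 -sqrf_eq0; apply/eqP.
  have -> : (r 0 1 + r 1 0) ^+ 2 =
      (r 0 0 ^+ 2 + r 1 0 ^+ 2) + (r 0 1 ^+ 2 + r 1 1 ^+ 2)
      - 2 * (r 0 0 * r 1 1 - r 0 1 * r 1 0) - (r 0 0 - r 1 1) ^+ 2 by ring.
  by rewrite o00 o11 dr e1; ring.
by split.
Qed.

Lemma mulmx_entry_bound m (A : 'M[R]_2) (B : 'M[R]_(2, m)) (a b : R) i j :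
  (forall i j, `|A i j| <= a) -> (forall i j, `|B i j| <= b) -> `|(A *m B) i j| <= 2 * a * b.
Proof.
move=> hA hB; rewrite mulmx2E (le_trans (ler_normD _ _)) // !normrM.
by have := hA i 0; have := hA i 1; have := hB 0 j; have := hB 1 j => b1 b0 a1 a0;
  have := ler_pM (normr_ge0 _) (normr_ge0 _) a0 b0;
  have := ler_pM (normr_ge0 _) (normr_ge0 _) a1 b1; lra.
Qed.

Lemma erot_entry x i j : `|erot x i j| <= 1.
Proof. exact/orth_entry/erotTK. Qed.

Section Upper.
Variable Phi : Gam k -> euc R.
Hypothesis Phi_hom : is_hom Phi.
Hypothesis Phi_inj : injective Phi.
Hypothesis Phi_discrete : discrete_image Phi.

Lemma discrete_at1 : exists2 e : R, 0 < e & forall g,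
  (forall i, `|etrans (Phi g) i 0| < e) ->
  (forall i j, `|(erot (Phi g) - 1%:M) i j| < e) -> g = 1%g.
Proof.
have [_ [V V1 VA]] : isolated (range (fun g => euc_parts (Phi g))) (euc_parts (Phi 1%g)).
  by apply: Phi_discrete; exists 1%g.
have [e /= e0 eV] := (nbhs_ballP _ _).1 V1.
exists e => // g ht hr; apply: Phi_inj; apply: val_inj => /=.
suff: (V `&` range (fun g => euc_parts (Phi g))) (euc_parts (Phi g)) by rewrite VA.
split; last by exists g.
apply: eV; split; split=> // i j; rewrite -ball_normE /ball_ /= (hom1 Phi_hom) /=.
  by rewrite mxE sub0r normrN (ord1 j); exact: ht.
by rewrite distrC; have := hr i j; rewrite 2!mxE.
Qed.

(** Rotational entries are bounded anyway, so bounded translation parts would bring two images close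
    together, and their quotient would be a nontrivial element too near the identity. *)
Lemma discrete_unbounded (g : nat -> Gam k) (B : R) : injective g ->
  ~ forall n i, `|etrans (Phi (g n)) i 0| <= B.
Proof.
move=> g_inj gB; have [e e0 he] := discrete_at1.
pose u (c : 'I_2 + 'I_2 * 'I_2) n := euc_coord (Phi (g n)) c.
(* The bound covers the translation parts as well as the rotational entries, which are at most 1.
   Multiplying by an orthogonal matrix costs a factor of at most 2, and twice [e / 4] is still below
   [e]. *)
have [|c n|i [j [ij dij]]] := @pigeonhole _ u (`|B| + 1) (e / 4%:R).
- by rewrite divr_gt0.
- rewrite /u; case: c => [i|[i j]] /=.
    by have := gB n i; have := ler_norm B; lra.
  by have := erot_entry (Phi (g n)) i j; have := normr_ge0 B; lra.
have dt a b : `|(etrans (Phi (g i)) - etrans (Phi (g j))) a b| <= e / 4%:R.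
  by rewrite !mxE (ord1 b); exact/ltW/(dij (inl a)).
have dr a b : `|(erot (Phi (g i)) - erot (Phi (g j))) a b| <= e / 4%:R.
  by rewrite !mxE; exact/ltW/(dij (inr (a, b))).
have o1 a b : `|(erot (Phi (g j)))^T a b| <= 1 by rewrite mxE erot_entry.
have : ((g j)^-1 * g i)%g = 1%g.
  apply: he => [a|a b]; rewrite Phi_hom (homV Phi_hom).
    rewrite etransM etransV erotV addrC -mulmxBr.
    by apply: le_lt_trans (mulmx_entry_bound _ _ o1 dt) _; lra.
  rewrite erotM erotV -(erotTK (Phi (g j))) -mulmxBr.
  by apply: le_lt_trans (mulmx_entry_bound _ _ o1 dr) _; lra.
move=> /(congr1 (fun h => g j * h)%g); rewrite mulgA mulgV mul1g mulg1 => /g_inj e'.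
by rewrite e' eqxx in ij.
Qed.

Lemma transl_inj : injective (@transl k).
Proof. by move=> a b []. Qed.

(** A nontrivial rotation of the plane has a fixed point, so all its powers would have bounded
    translation parts, although the multiples of [t] are distinct. *)
Lemma erot_transl_det1 t : \det (erot (Phi (transl k t))) = 1 ->
  erot (Phi (transl k t)) = 1%:M.
Proof.
set x := Phi (transl k t); set r := erot x => dr.
have [t0|t0] := eqVneq t 0; first by rewrite /r /x t0 (hom1 Phi_hom).
apply: contrapT => r1.
have ort := erotTK x; rewrite -/r in ort.
have [e1 e2 o00] := rotation_entries ort dr.
have u1 : 1%:M - r \in unitmx.
  rewrite unitmxE unitfE det2E !mxE /= e1 e2; apply/eqP => d0; apply: r1.
  have r00 : r 0 0 = 1 by nra.
  have r10 : r 1 0 = 0 by apply/eqP; rewrite -sqrf_eq0; apply/eqP; nra.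
  by apply: mx2P; rewrite ?e1 ?e2 ?r00 ?r10 !mxE ?oppr0.
have [c cE] : exists c, etrans x = c - r *m c.
  exists (invmx (1%:M - r) *m etrans x).
  by rewrite -[X in X - _]mul1mx -mulmxBl mulmxA mulmxV // mul1mx.
have xn n : etrans (x ^+ n)%g = c - r ^+ n *m c.
  elim: n => [|n IH]; first by rewrite expg0 expr0 mul1mx subrr.
  rewrite expgS etransM IH cE -/r mulmxBr mulmxA exprS mulmxE; move: (r *m c) => y.
  by rewrite addrA subrK.
pose b := `|c 0 0| + `|c 1 0|.
have cb i j : `|c i j| <= b.
  by rewrite (ord1 j) /b; move: i; apply: ord2P; rewrite ?lerDl ?lerDr.
apply: (@discrete_unbounded (fun n => transl k (t *+ n)) (b + 2 * 1 * b)).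
  have [i ti] : exists i, t i 0 != 0.
    apply: contrapT => /forallNP h; case/eqP: t0; apply/matrixP => i j.
    by rewrite mxE (ord1 j); apply/eqP/negPn/negP/h.
  move=> m n /transl_inj /(congr1 (fun A : 'cV[int]_2 => A i 0)); rewrite !mulmxnE.
  exact: mulrIn.
move=> n i; have -> : Phi (transl k (t *+ n)) = (x ^+ n)%g.
  elim: n => [|n IH]; first by rewrite expg0 -(hom1 Phi_hom).
  by rewrite mulrS translD Phi_hom IH expgS.
rewrite xn 2!mxE; apply: le_trans (ler_normB _ _) _; apply: lerD => //.
apply: mulmx_entry_bound => // a a'; rewrite -erotX; exact: erot_entry.
Qed.

(* If the columns of [M] were dependent, integer combinations of them along a
   strip would stay bounded. *)
Lemma lattice_indep M n : (0 < n)%N ->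
  (forall t, etrans (Phi (transl k (t *+ n))) = M *m toR R t) -> M \in unitmx.
Proof.
move=> n0 hM; rewrite unitmxE unitfE; apply/eqP => d0.
suff [T [b T_inj Tb]] : exists T : nat -> 'cV[int]_2, exists2 b : R, injective T &
    forall m i, `|(M *m toR R (T m)) i 0| <= b.
  apply: (@discrete_unbounded (fun m => transl k (T m *+ n)) b).
    move=> m m' /transl_inj /matrixP e; apply: T_inj; apply/matrixP => i j.
    by have := e i j; rewrite !mulmxnE; exact: pmulrnI.
  by move=> m i; rewrite hM.
rewrite det2E in d0.
have [[l hl]|M1] : (exists l, forall i, M i 0 = l * M i 1) \/ (forall i, M i 1 = 0).
- have [M01|M01] := eqVneq (M 0 1) 0; last first.
    left; exists (M 0 0 / M 0 1); apply: ord2P; first by rewrite divfK.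
    by apply: (mulfI M01); rewrite [RHS]mulrA (mulrC (M 0 1) (_ / _)) divfK //; lra.
  have [M11|M11] := eqVneq (M 1 1) 0; last first.
    left; exists (M 1 0 / M 1 1); apply: ord2P; last by rewrite divfK.
    rewrite M01 mulr0; apply: (mulIf M11); rewrite mul0r.
    by move: d0; rewrite M01 mul0r subr0.
  by right; apply: ord2P.
- exists (fun m => \col_i if i == 0 then m%:Z else - Num.floor (l * m%:R)).
  exists (`|M 0 1| + `|M 1 1|); first by move=> m m' /matrixP/(_ 0 0); rewrite !mxE /= => -[].
  move=> m i; rewrite mulmx2E !mxE /= -pmulrn hl.
  rewrite -mulrA mulrCA -mulrDr normrM -[leRHS]mulr1; apply: ler_pM => //.
    by move: i; apply: ord2P; rewrite ?lerDl ?lerDr.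
  have /andP[f1 f2] := floor_itv (l * m%:R).
  by rewrite mulrNz ler_norml; rewrite intrD in f2; apply/andP; split; lra.
exists (fun m => \col_i if i == 0 then 0 else m%:Z), 0.
  by move=> m m' /matrixP/(_ 1 0); rewrite !mxE /= => -[].
by move=> m i; rewrite mulmx2E !mxE /= M1 mulr0 mul0r addr0 normr0.
Qed.

(** A priori the image of a translation could be a glide reflection, but the rotational part of its
    square has determinant 1 and is thus trivial. These squares span the plane and commute with the
    original, whose rotational part therefore fixes every vector. *)
Lemma erot_translation t : erot (Phi (transl k t)) = 1%:M.
Proof.
have sq t' : erot (Phi (transl k (t' *+ 2))) = 1%:M.
  apply: erot_transl_det1; rewrite mulr2n translD Phi_hom erotM det_mulmx.
  by have := congr1 determinant (erotTK (Phi (transl k t'))); rewrite det_mulmx det_tr det1.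
pose M : 'M[R]_2 := \matrix_(i, j) etrans (Phi (transl k (delta_mx j 0 *+ 2))) i 0.
have hM t' : etrans (Phi (transl k (t' *+ 2))) = M *m toR R t'.
  elim/lattice_ind: t' => [a b ea eb|i]; last first.
    rewrite /toR map_delta_mx -colE; apply/matrixP => a b.
    by rewrite !mxE (ord1 b).
  rewrite mulrnBl translD translN Phi_hom (homV Phi_hom) etransM ea sq mul1mx.
  rewrite /toR map_mxD map_mxN mulmxDr mulmxN; congr (_ + _).
  by rewrite etransV sq trmx1 mul1mx eb.
have uM : M \in unitmx by exact: (lattice_indep _ hM).
have rM : erot (Phi (transl k t)) *m M = M.
  suff E t' : erot (Phi (transl k t)) *m M *m toR R t' = M *m toR R t'.
    apply/matrixP => i j; have := E (delta_mx j 0).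
    by rewrite /toR map_delta_mx -!colE => /matrixP/(_ i 0); rewrite !mxE.
  have e : (transl k t * transl k (t' *+ 2) = transl k (t' *+ 2) * transl k t)%g.
    by rewrite -!translD addrC.
  have /(congr1 (@etrans R)) := congr1 Phi e.
  rewrite !Phi_hom !etransM sq mul1mx [RHS]addrC => /addrI.
  by rewrite !hM mulmxA.
by rewrite -[LHS](mulmxK uM) rM mulmxV.
Qed.

Lemma etrans_translation t : etrans (Phi (transl k t)) = colM Phi *m toR R t.
Proof. by apply: etrans_transl => // i; exact: erot_translation. Qed.

Lemma colM_unit : colM Phi \in unitmx.
Proof. by apply: (@lattice_indep _ 1) => // t; rewrite mulr1n etrans_translation. Qed.

Definition mirror : 'M[R]_2 := mx2 1 0 0 (-1).

(* The rotational part of the generator is conjugate to its action on the lattice,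
   hence a rotation by the same angle up to sign. *)
Lemma colM_intertwines_mirror : intertwines k (colM Phi) \/ intertwines k (mirror *m colM Phi).
Proof.
have MA := colM_intertwines Phi_hom (fun i => erot_translation (delta_mx i 0)).
have [M0 M0A uM0] := intertwiner_exists R k.
set r := erot _ in MA; set M := colM Phi in MA *; have uM : M \in unitmx := colM_unit.
have detA : \det latR = 1.
  have := congr1 determinant M0A; rewrite !det_mulmx -[\det rotR]/(\det (rotR ^+ 1)).
  rewrite det_rotR mul1r => /(canRL (mulKf _)) -> //.
    by rewrite mulVf // -unitfE -unitmxE.
  by rewrite -unitfE -unitmxE.
have rE : r = M *m latR *m invmx M by rewrite MA mulmxK.
have detr : r 0 0 * r 1 1 - r 0 1 * r 1 0 = 1.
  by rewrite -det2E rE !det_mulmx detA mulr1 det_inv mulrV // -unitmxE.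
have trr : r 0 0 + r 1 1 = 2 * cos (2 * pi / (order_of k)%:R).
  rewrite rotR_trace -(sum2 (fun i => r i i)) -[LHS]/(\tr r) rE mxtrace_mulC mulKmx //.
  by rewrite /mxtrace !sum2 !mxE intrD.
have ort := erotTK (Phi (r_ k)); rewrite -/r in ort.
rewrite -det2E in detr; have [e1 e2 o00] := rotation_entries ort detr.
set c := cos _ in trr; have c2s2 := cos2Dsin2 (2 * pi / (order_of k)%:R : R).
have r00 : r 0 0 = c by rewrite e1 in trr; lra.
have /eqP : r 1 0 ^+ 2 = sin (2 * pi / (order_of k)%:R) ^+ 2.
  by rewrite r00 in o00; move: o00 c2s2; rewrite -/c => <- /addrI.
rewrite eqf_sqr /intertwines => /orP[/eqP r10|/eqP r10]; [left|right].
  rewrite MA; congr (_ *m _); apply: mx2P; rewrite !mxE /= ?e1 ?e2 ?r00 ?r10 //.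
rewrite -mulmxA MA !mulmxA; congr (_ *m _); apply: mx2P;
  by rewrite !mulmx2E !mxE /= ?e1 ?e2 ?r00 ?r10 -/c; ring.
Qed.

End Upper.
End DiscreteReps.

(** * Representations built from a lattice matrix and a rotation center *)

Section AffineReps.
Variables (R : realType) (k : crystal).
Implicit Types (M : 'M[R]_2) (g h : Gam k) (c q : 'cV[R]_2) (x : euc R).
Local Notation rotR := (rotR R k).

Fact affine_rep_subproof M c g :
  ((aff M g (- c) + c, rotR ^+ g.2) : 'cV[R]_2 * 'M[R]_2).2^T *m (rotR ^+ g.2) == 1%:M.
Proof. by rewrite rotR_orth. Qed.

Definition affine_rep M c g : euc R := Euc (affine_rep_subproof M c g).

Lemma etrans_affine_rep M c g : etrans (affine_rep M c g) = aff M g (- c) + c.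
Proof. by []. Qed.

Lemma erot_affine_rep M c g : erot (affine_rep M c g) = rotR ^+ g.2.
Proof. by []. Qed.

Lemma eapp_affine_rep M c g q : eapp (affine_rep M c g) q = aff M g (q - c) + c.
Proof.
rewrite /eapp etrans_affine_rep erot_affine_rep /aff addrAC; congr (_ + c).
by rewrite -addrA -mulmxDr (addrC (- c)).
Qed.

Lemma affine_rep_hom M c : intertwines k M -> is_hom (affine_rep M c).
Proof.
move=> MA g h; apply: eapp_inj => q.
by rewrite eappM !eapp_affine_rep affM // addrK.
Qed.

Lemma aff_transl0 M g c : aff M g (- c) + c = M *m toR R g.1 + (1%:M - rotR ^+ g.2) *m c.
Proof. by rewrite /aff mulmxN mulmxBl mul1mx -addrA (addrC (- _)). Qed.

Lemma affine_rep_bar M c : intertwines k M -> Rep_bar (affine_rep M c).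
Proof.
move=> MA; split.
- exact: affine_rep_hom.
- by move=> i; rewrite erot_affine_rep expr0.
- by move=> _; rewrite erot_affine_rep rotR_inZp expr1.
move=> k346; rewrite !etrans_affine_rep !aff_transl0 /= expr0 subrr !mul0mx !addr0.
rewrite mulmxA -MA -mulmxA /latR -map_mxM; congr (_ *m map_mx _ _).
by rewrite -colE; case: k346 => [->|[->|->]]; apply: cV2P; rewrite !mxE.
Qed.

(** For order at least 2 the matrix [1%:M - rotR] is invertible, so the image of the generator has a
    center [c]. For order 1 the generator is the identity, and 0 is taken for [c]. *)
Lemma rep_bar_affine (Phi : Gam k -> euc R) : Rep_bar Phi ->
  exists M c, intertwines k M /\ Phi = affine_rep M c.
Proof.
move=> [hom et er _].
have erR : erot (Phi (r_ k)) = rotR.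
  have [kP1|/er //] := pselect (k = P1).
  have -> : r_ k = 1%g.
    by apply: Gam_eq => //; apply: val_inj; rewrite /r_ /=; case: (k) kP1.
  have := rotR_order R k; rewrite (hom1 hom) (_ : (order_of k).-1.+1 = 1)%N ?expr1 //.
  by rewrite kP1.
have MA := colM_intertwines hom et; rewrite erR in MA.
have [c wE] : exists c, etrans (Phi (r_ k)) = (1%:M - rotR) *m c.
  have [s0|s0] := eqVneq (inZp 1 : 'I_(order_of k).-1.+1) 0.
    exists 0; rewrite mulmx0 (_ : r_ k = 1%g) ?(hom1 hom) //.
    by apply: Gam_eq => //=; rewrite s0.
  have := rotR_fixed_free R s0; rewrite rotR_inZp expr1 => u.
  by exists (invmx (1%:M - rotR) *m etrans (Phi (r_ k))); rewrite mulmxA mulmxV // mul1mx.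
exists (colM Phi), c; split=> //; apply/funext => g; apply: euc_eq; last first.
  by rewrite (erot_Gam hom et) erR.
rewrite etrans_affine_rep aff_transl0 [in LHS](Gam_split g) hom etransM.
rewrite (erot_transl hom et) mul1mx (etrans_transl hom et); congr (_ + _).
rewrite rot_r_X; elim: (val g.2) => [|n IH].
  by rewrite expg0 (hom1 hom) expr0 subrr mul0mx.
rewrite expgS hom etransM IH wE erR exprS -mulmxE !mulmxBl !mul1mx mulmxBr mulmxA.
by rewrite addrA subrK.
Qed.

Lemma affine_rep_trivial M c : trivial_rep (affine_rep M c) <-> M = 0.
Proof.
split=> [tr|-> g [_ g0]]; last first.
  apply: euc_eq; last by rewrite erot_affine_rep g0 expr0.
  by rewrite etrans_affine_rep aff_transl0 g0 expr0 subrr !mul0mx addr0.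
suff E i : M *m toR R (delta_mx i 0) = 0.
  apply/matrixP => i j; have := E j.
  by rewrite /toR map_delta_mx -colE => /matrixP/(_ i 0); rewrite !mxE.
have /(congr1 (@etrans R)) := tr (t_ k i) (conj I erefl).
by rewrite etrans_affine_rep aff_transl0 /= expr0 subrr mul0mx addr0.
Qed.

Lemma int_lt1 (z : int) : `|z%:~R : R| < 1 -> z = 0.
Proof. by rewrite -intr_norm (ltrz1 _ `|z|) => ?; lia. Qed.

Lemma entry_le_sum (A : 'M[R]_2) i j : `|A i j| <= \sum_a \sum_b `|A a b|.
Proof.
rewrite (bigD1 i) //= (bigD1 j) //= -addrA lerDl.
by rewrite addr_ge0 // sumr_ge0 // => a _; rewrite sumr_ge0.
Qed.

(** For discreteness: in the basis given by [M], translation and rotational parts are integral, so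
    elements that are close enough coincide. *)
Theorem affine_rep_Rep M : intertwines k M -> M \in unitmx -> Rep (affine_rep M 0).
Proof.
move=> MA uM; split.
- exact: affine_rep_hom.
- move=> g h e; have /(congr1 (@etrans R)) := e; have /(congr1 (@erot R)) := e.
  rewrite !erot_affine_rep !etrans_affine_rep !aff_transl0 !mulmx0 !addr0 => er et.
  apply: Gam_eq.
    apply/matrixP => i j; have := congr1 (mulmx (invmx M)) et.
    by rewrite !mulKmx // => /matrixP/(_ i j); rewrite !mxE => /eqP; rewrite eqr_int => /eqP.
  apply/eqP; rewrite -subr_eq0; apply/eqP/(@rotR_eq1 R k).
  rewrite rotRD er -rotRD subrr; exact: rotR0.
- move=> _ [g _ <-]; split; first by rewrite inE; exists g.
  pose b := (\sum_i \sum_j `|M i j|) + (\sum_i \sum_j `|invmx M i j|) + 1.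
  have Ms i j := entry_le_sum M i j; have Vs i j := entry_le_sum (invmx M) i j.
  have Mb i j : `|M i j| <= b.
    by have := Ms i j; have := Vs i j; have := normr_ge0 (invmx M i j); rewrite /b; lra.
  have Vb i j : `|invmx M i j| <= b.
    by have := Ms i j; have := Vs i j; have := normr_ge0 (M i j); rewrite /b; lra.
  have b1 : 1 <= b.
    have := Ms 0 0; have := Vs 0 0; have := normr_ge0 (invmx M 0 0).
    by have := normr_ge0 (M 0 0); rewrite /b; lra.
  (* Recovering the integers multiplies the error by at most [2 * b] for translations and
     [4 * b ^+ 2] for rotations; this [e] keeps both products below 1. The summand 1 in [b] ensures
     that [b] is at most its square. *)
  pose e : R := (8%:R * b ^+ 2)^-1.
  have b0 : 0 < b by exact: lt_le_trans b1.
  have e0 : 0 < e by rewrite invr_gt0 mulr_gt0 // exprn_gt0.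
  have eb : e * b ^+ 2 = 8%:R^-1.
    by rewrite /e invfM -mulrA mulVf ?mulr1 // expf_neq0 // gt_eqF.
  have eb' : e * b <= 8%:R^-1.
    by rewrite -eb ler_pM2l // expr2 ler_peMl // ltW.
  clearbody e b.
  exists (ball (euc_parts (affine_rep M 0 g)) e); first exact: nbhsx_ballx.
  apply/seteqP; split=> [y [[bt br] [h _ hy]]|_ ->]; last by split; [exact: ballxx|exists g].
  rewrite -{y}hy in bt br *.
  have bt' i : `|(M *m toR R (h.1 - g.1)) i 0| <= e.
    have := bt.2 i 0; rewrite -ball_normE /ball_ /= !aff_transl0 !mulmx0 !addr0 => /ltW.
    by rewrite distrC /toR map_mxB mulmxBr !mxE.
  have br' i j : `|(rotR ^+ h.2 - rotR ^+ g.2) i j| <= e.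
    have := br.2 i j; rewrite -ball_normE /ball_ /= => /ltW.
    by rewrite distrC !mxE.
  have et : h.1 = g.1.
    apply/eqP; rewrite -subr_eq0; apply/eqP/matrixP => i j; rewrite (ord1 j) [RHS]mxE.
    apply: int_lt1; have -> : ((h.1 - g.1) i 0)%:~R = (invmx M *m (M *m toR R (h.1 - g.1))) i 0.
      by rewrite mulKmx // [RHS]mxE.
    have bt2 a a' : `|(M *m toR R (h.1 - g.1)) a a'| <= e by rewrite (ord1 a').
    by apply: le_lt_trans (mulmx_entry_bound i 0 Vb bt2) _; lra.
  congr (euc_parts (affine_rep M 0 _)).
  suff es : h.2 = g.2 by exact: Gam_eq.
  apply/eqP; rewrite -subr_eq0; apply/eqP/(@rotR_eq1 R k).
  rewrite rotRD; suff -> : rotR ^+ h.2 = rotR ^+ g.2 by rewrite -rotRD subrr; exact: rotR0.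
  have E (s : 'I_(order_of k).-1.+1) : rotR ^+ s = M *m map_mx intr (lattice_mx k ^+ s) *m invmx M.
    by rewrite -latRX (intertwinesX _ MA) mulmxK.
  rewrite !E; congr (_ *m map_mx _ _ *m _).
  apply/eqP; rewrite -subr_eq0; apply/eqP/matrixP => i j; rewrite [RHS]mxE.
  apply: int_lt1; set D := _ - _.
  have -> : (D i j)%:~R = (invmx M *m (rotR ^+ h.2 - rotR ^+ g.2) *m M) i j.
    rewrite !E -mulmxBl -mulmxBr -map_mxB -/D mulmxA mulmxA mulmxKV //.
    by rewrite mulVmx // mul1mx [RHS]mxE.
  have h1 a a' := mulmx_entry_bound a a' Vb br'.
  apply: le_lt_trans (mulmx_entry_bound i j h1 Mb) _.
  have -> : 2 * (2 * b * e) * b = 4%:R * (e * b ^+ 2) by ring.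
  by rewrite eb; lra.
by move=> kP1 g; rewrite erot_affine_rep -rot_partE /rot_part; case: (k) kP1 g.
Qed.

End AffineReps.

(** * The dimension of the space of extendable representations *)

Section VspacePred.
Variables (K : fieldType) (vT : vectType K).

(** A subspace of maximal dimension among those contained in [P] is all of [P], since any further
    vector could be adjoined. *)
Lemma vspace_of_pred (P : vT -> Prop) : P 0 ->
  (forall a x y, P x -> P y -> P (a *: x + y)) ->
  exists U : {vspace vT}, forall x, (x \in U) <-> P x.
Proof.
move=> P0 PD; pose Q n := `[< exists U : {vspace vT},
  (forall x, x \in U -> P x) /\ \dim U = n >].
have exQ : exists n, Q n.
  exists 0%N; apply/asboolP; exists 0%VS; split; last exact: dimv0.
  by move=> x; rewrite memv0 => /eqP ->.
have boundQ n : Q n -> (n <= \dim {:vT})%N.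
  by move=> /asboolP[U [_ <-]]; apply/dimvS/subvf.
case: (ex_maxnP exQ boundQ) => n /asboolP[U [UP dU]] max_n.
exists U => x; split=> [/UP //|Px]; apply/negPn/negP => xU.
have /max_n : Q (\dim (U + <[x]>)%VS).
  apply/asboolP; exists (U + <[x]>)%VS; split=> // _ /memv_addP[u /UP Pu [_ /vlineP[a ->] ->]].
  by rewrite addrC; exact: PD.
rewrite -dU leqNgt ltn_neqAle dimvS ?addvSl // andbT negbK => /eqP e.
case/negP: xU; rewrite memvE; apply: subv_trans (addvSr U _) _.
by have /eqP <- : U == (U + <[x]>)%VS by rewrite eqEdim addvSl e leqnn.
Qed.

Lemma proper_subspace_relation n (W : {vspace 'rV[K]_n}) : (\dim W < n)%N ->
  exists2 c : 'I_n -> K, exists j, c j != 0 & forall w, w \in W -> \sum_j c j * w 0 j = 0.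
Proof.
move=> dW; pose A : 'M[K]_(\dim W, n) := \matrix_(i, j) (vbasis W)`_i 0 j.
have /rowV0Pn[c /sub_kermxP cA c0] : kermx A^T != 0.
  by rewrite -mxrank_eq0 mxrank_ker mxrank_tr -lt0n subn_gt0 (leq_ltn_trans (rank_leq_row A)).
exists (c 0).
  by apply: contrapT => /forallNP h; case/eqP: c0; apply/rowP => j; rewrite mxE;
    apply/eqP/negPn/negP/h.
move=> w wW; rewrite (coord_vbasis wW).
rewrite (eq_bigr (fun j => \sum_i coord (vbasis W) i w * (c 0 j * A i j))).
  rewrite exchange_big big1 //= => i _; rewrite -mulr_sumr.
  have /rowP/(_ i) := cA; rewrite !mxE => e.
  by rewrite (_ : \sum_j _ = 0) ?mulr0 // -[RHS]e; apply: eq_bigr => j _; rewrite !mxE.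
move=> j _; rewrite summxE mulr_sumr; apply: eq_bigr => i _.
by rewrite !mxE mulrCA.
Qed.

End VspacePred.

Section RepDimension.
Variables (R : realType) (k : crystal).
Implicit Types (M : 'M[R]_2) (g h : Gam k).
Local Notation rotR := (rotR R k).
Local Notation latR := (latR R k).

Definition defect M := M *m latR - rotR *m M.

Fact defect_is_linear : linear defect.
Proof.
move=> a M N; rewrite /defect mulmxDl mulmxDr -scalemxAl -scalemxAr.
by rewrite scalerBr opprD addrACA.
Qed.
HB.instance Definition _ := GRing.isLinear.Build R 'M[R]_2 'M[R]_2 *:%R defect defect_is_linear.

Definition intertwiners : {vspace 'M[R]_2} := lker (linfun defect).

Lemma memv_intertwiners M : (M \in intertwiners) <-> intertwines k M.
Proof.
rewrite memv_ker lfunE /= /defect subr_eq0; split; first by move/eqP.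
by rewrite /intertwines => ->.
Qed.

Lemma adimE (I : Type) (X : set (I -> R)) d :
  (exists s : 'I_d -> I, algebraically_independent X s) ->
  (forall d' (s : 'I_d' -> I), algebraically_independent X s -> (d' <= d)%N) ->
  adim X = d.
Proof.
move=> ex ub; have h : [set d | (exists s : 'I_d -> I, algebraically_independent X s) /\
    (forall d' (s : 'I_d' -> I), algebraically_independent X s -> (d' <= d)%N)] d by [].
have [[s hs] ub'] := xgetPex 0%N (ex_intro _ d h).
apply/eqP; rewrite eqn_leq (ub _ s hs) /=.
by have [s' hs'] := ex; exact: ub' hs'.
Qed.

Definition coord_form g (c : 'I_2 + 'I_2 * 'I_2) M : R^o :=
  if c is inl i then (M *m toR R g.1) i 0 else 0.

Fact coord_form_is_linear g c : linear (coord_form g c).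
Proof.
move=> a M N; case: c => [i|ij] /=; last by rewrite scaler0 addr0.
by rewrite mulmxDl -scalemxAl 2!mxE.
Qed.
HB.instance Definition _ g c := GRing.isLinear.Build R 'M[R]_2 R^o *:%R (coord_form g c)
  (coord_form_is_linear g c).

Definition coord_const (c : 'I_2 + 'I_2 * 'I_2) : R :=
  if c is inr (i, j) then (1%:M : 'M[R]_2) i j else 0.

Definition coord_sign (c : 'I_2 + 'I_2 * 'I_2) : R :=
  if c is inl i then (-1) ^+ i else 1.

Lemma coord_form_mirror g c M :
  coord_form g c (mirror R *m M) = coord_sign c * coord_form g c M.
Proof.
case: c => [i|ij] /=; last by rewrite mulr0.
rewrite -mulmxA mulmx2E !mxE; move: i; apply: ord2P => /=; rewrite ?expr0 ?expr1; ring.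
Qed.

Lemma coord_Rep (Phi : Gam k -> euc R) g c : Rep Phi -> g.2 = 0 ->
  euc_coord (Phi g) c = coord_form g c (colM Phi) + coord_const c.
Proof.
move=> [hom inj disc _] g0; have -> : g = transl k g.1 by exact: Gam_eq.
case: c => [i|[i j]] /=; first by rewrite addr0 (etrans_translation hom inj disc).
by rewrite add0r (erot_translation hom inj disc).
Qed.

Lemma colM_affine_rep M : colM (affine_rep (k := k) M 0) = M.
Proof.
apply/matrixP => i j; rewrite mxE etrans_affine_rep aff_transl0 mulmx0 addr0.
by rewrite /toR map_delta_mx -colE mxE.
Qed.

Variables (H : set (Gam k)) (U : {vspace 'M[R]_2}).
Hypothesis H_transl : forall h, H h -> h.2 = 0.
Hypothesis H_1 : H 1%g.
Hypothesis memU : forall M, (M \in U) <->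
  M \in intertwiners /\ forall h, H h -> M *m toR R h.1 = 0.

Let D := (\dim intertwiners - \dim U)%N.
Let X := [set (fun gc : H * ('I_2 + 'I_2 * 'I_2) => euc_coord (phi gc.1) gc.2)
             | phi in @extendable_reps R k H].

Let form (gc : H * ('I_2 + 'I_2 * 'I_2)) : 'Hom('M[R]_2, R^o) :=
  linfun (coord_form (\val gc.1) gc.2).

Let valH (g : H) : H (\val g).
Proof. exact: set_valP. Qed.

Let UV : (U <= intertwiners)%VS.
Proof. by apply/subvP => M /memU[]. Qed.

Let X_Rep (Phi : Gam k -> euc R) : Rep Phi ->
  X (fun gc => form gc (colM Phi) + coord_const gc.2).
Proof.
move=> Phi_Rep; exists (fun g : H => Phi (\val g)); first by exists Phi.
by apply/funext => gc; rewrite coord_Rep ?lfunE //; exact/H_transl/valH.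
Qed.

(* The lattice vectors lie in one of two mirror images of [intertwiners]; a linear
   relation on each of them gives a polynomial relation, their product. *)
Let rep_upper d (s : 'I_d -> H * ('I_2 + 'I_2 * 'I_2)) :
  algebraically_independent X s -> (d <= D)%N.
Proof.
move=> indep; rewrite leqNgt; apply/negP => ltDd.
pose f M : 'rV[R]_d := \row_j form (s j) M.
have f_lin : linear f by move=> a M N; apply/rowP => j; rewrite !mxE linearP.
pose fL : {linear 'M[R]_2 -> 'rV[R]_d} := HB.pack f (GRing.isLinear.Build _ _ _ _ f f_lin).
pose W := (linfun fL @: intertwiners)%VS.
have fE M : linfun fL M = f M by rewrite lfunE.
have dW : (\dim W <= D)%N.
  rewrite /D -(limg_ker_dim (linfun fL) intertwiners) -/W addnC.
  suff UK : (U <= intertwiners :&: lker (linfun fL))%VS.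
    by rewrite -addnBA ?leq_addr ?dimvS.
  apply/subvP => M MU; rewrite memv_cap (subvP UV) //= memv_ker fE.
  apply/eqP/rowP => j; rewrite !mxE lfunE; case: (s j).2 => [i|//] /=.
  by have [_ ->] := (memU M).1 MU; rewrite ?mxE //; exact: valH.
have [c [j0 cj0] cW] := proper_subspace_relation (leq_ltn_trans dW ltDd).
have rel M : M \in intertwiners -> \sum_j c j * form (s j) M = 0.
  move=> MV; rewrite -[RHS](cW (linfun fL M)) ?memv_img //.
  by apply: eq_bigr => j _; rewrite fE mxE.
pose Q (a : 'I_d -> R) : mpoly.mpoly d R :=
  \sum_j mpoly.mpolyC d (a j) * (mpoly.mpolyX R (mpoly.mnm1 j) - mpoly.mpolyC d (coord_const (s j).2)).
have QE a v : mpoly.meval v (Q a) = \sum_j a j * (v j - coord_const (s j).2).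
  rewrite raddf_sum; apply: eq_bigr => j _.
  by rewrite /= mpoly.mevalM mpoly.mevalB !mpoly.mevalC mpoly.mevalXU.
have Qn0 a : a j0 != 0 -> Q a != 0.
  apply: contra => /eqP Q0; apply/eqP.
  have := QE a (fun j => (j == j0)%:R + coord_const (s j).2).
  rewrite Q0 mpoly.meval0 (bigD1 j0) //= addrK eqxx mulr1 big1 ?addr0 => [<- //|j /negPf jn].
  by rewrite addrK jn mulr0.
have /indep /eqP : forall x, X x ->
    mpoly.meval (fun j => x (s j)) (Q c * Q (fun j => c j * coord_sign (s j).2)) = 0.
  move=> _ [phi [Phi Phi_Rep phiE] <-]; have [hom inj disc _] := Phi_Rep.
  have xE gc : euc_coord (phi gc.1) gc.2 = form gc (colM Phi) + coord_const gc.2.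
    by rewrite phiE coord_Rep ?lfunE //; exact/H_transl/valH.
  rewrite mpoly.mevalM !QE.
  have [MV|MV] := colM_intertwines_mirror hom inj disc.
    rewrite (eq_bigr (fun j => c j * form (s j) (colM Phi))) ?rel ?mul0r //.
      exact/memv_intertwiners.
    by move=> j _; rewrite xE addrK.
  rewrite mulrC (eq_bigr (fun j => c j * form (s j) (mirror R *m colM Phi))) ?rel ?mul0r //.
    exact/memv_intertwiners.
  by move=> j _; rewrite xE addrK [in RHS]lfunE /= coord_form_mirror lfunE mulrA.
rewrite mulf_eq0 (negPf (Qn0 _ cj0)) (negPf (Qn0 _ _)) //.
by rewrite mulf_neq0 //; case: (s j0).2 => [i|?] /=; rewrite ?signr_eq0 ?oner_neq0.
Qed.

(** Greedy choice: while the common kernel is larger than [U], some coordinate of some element of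
    [H] is nonzero on it and cuts off one more dimension. *)
Let rep_forms n : (n <= D)%N -> exists s : nat -> H * 'I_2,
  (\dim (intertwiners :&: \bigcap_(j < n) lker (form ((s j).1, inl (s j).2)))
    = \dim intertwiners - n)%N.
Proof.
elim: n => [|n IH] nD.
  by exists (fun=> (SigSub (mem_set H_1), 0)); rewrite big_ord0 capvf subn0.
have [s ds] := IH (ltnW nD); set W := (_ :&: _)%VS in ds.
have /subvPn[M MW MU] : ~~ (W <= U)%VS.
  by apply/negP => /dimvS; rewrite ds; have := dimvS UV; rewrite /D in nD *; lia.
have [h Hh [i Mi]] : exists2 h, H h & exists i, (M *m toR R h.1) i 0 != 0.
  apply: contrapT => no; case/negP: MU; apply/memU; split.
    by move: MW; rewrite memv_cap => /andP[].
  move=> h Hh; apply/matrixP => i j; rewrite (ord1 j) [RHS]mxE; apply/eqP/negPn/negP => ne.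
  by apply: no; exists h => //; exists i.
pose x : H * 'I_2 := (SigSub (mem_set Hh), i).
exists (fun j => if j == n then x else s j); rewrite big_ord_recr /= eqxx capvA.
have -> : (intertwiners :&: \bigcap_(j < n) lker (form
    ((if j == n :> nat then x else s j).1, inl (if j == n :> nat then x else s j).2)))%VS = W.
  by congr capv; apply: eq_bigr => j _; rewrite ltn_eqF.
have := limg_ker_dim (form (x.1, inl x.2)) W.
have -> : \dim (form (x.1, inl x.2) @: W) = 1%N.
  apply/eqP; rewrite eqn_leq; apply/andP; split.
    by apply: leq_trans (dimvS (subvf _)) _; rewrite dimvf.
  rewrite lt0n dimv_eq0; apply/negP => /eqP W0.
  have := memv_img (form (x.1, inl x.2)) MW; rewrite W0 memv0 lfunE /= => /eqP e.
  by case/eqP: Mi.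
by rewrite ds subnS => <-; rewrite addn1.
Qed.

Let rep_lower : exists s : 'I_D -> H * ('I_2 + 'I_2 * 'I_2), algebraically_independent X s.
Proof.
have [s ds] := rep_forms (leqnn D).
pose s' (j : 'I_D) : H * ('I_2 + 'I_2 * 'I_2) := ((s j).1, inl (s j).2).
exists s' => P PX; apply: meval_eq0 => v.
pose f M : 'rV[R]_D := \row_j form (s' j) M.
have f_lin : linear f by move=> a M N; apply/rowP => j; rewrite !mxE linearP.
pose fL : {linear 'M[R]_2 -> 'rV[R]_D} := HB.pack f (GRing.isLinear.Build _ _ _ _ f f_lin).
have fE M : linfun fL M = f M by rewrite lfunE.
have surj : (linfun fL @: intertwiners)%VS = fullv.
  have dD : \dim (fullv : {vspace 'rV[R]_D}) = D by rewrite dimvf dim_matrix; exact: mul1n.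
  apply/eqP; rewrite eqEdim subvf dD.
  have := limg_ker_dim (linfun fL) intertwiners.
  have -> : (intertwiners :&: lker (linfun fL))%VS =
      (intertwiners :&: \bigcap_(j < D) lker (form (s' j)))%VS.
    apply/vspaceP => M; rewrite !memv_cap; congr andb; rewrite memv_ker fE.
    apply/eqP/idP => [/rowP h|].
      rewrite memvE; apply/subv_bigcapP => j _; rewrite -memvE memv_ker.
      by have := h j; rewrite !mxE => ->.
    rewrite memvE => /subv_bigcapP h; apply/rowP => j; have := h j isT.
    by rewrite -memvE memv_ker !mxE => /eqP.
  by rewrite ds => e; rewrite -(leq_add2l (\dim intertwiners - D)) e subnK; [exact: leqnn|exact: leq_subr].
have /memv_imgP[M MV Mv] : \row_j v j \in (linfun fL @: intertwiners)%VS.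
  by rewrite surj memvf.
(* Only invertible matrices give discrete faithful representations, so the preimage [M] of [v] is
   moved along an invertible [M0]. The determinant is a nonzero polynomial in [t] and the relation
   [P] holds wherever it does not vanish, hence identically, in particular at [t = 0]. *)
have [M0 M0V uM0] := intertwiner_exists R k.
have [q qE] := meval_line P v (fun j => form (s' j) M0).
pose b := M 0 0 * M0 1 1 + M 1 1 * M0 0 0 - M 0 1 * M0 1 0 - M 1 0 * M0 0 1.
pose r : {poly R} := Poly [:: \det M; b; \det M0].
have rE t : r.[t] = \det (M + t *: M0).
  by rewrite horner_Poly /= !det2E !mxE /b; ring.
have r0 : r != 0.
  apply/eqP => e; have := congr1 (fun p : {poly R} => p`_2) e.
  rewrite coef0 coef_Poly /= => d0.
  by move: uM0; rewrite unitmxE d0 unitr0.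
have qr : q * r = 0.
  apply: poly_fun_eq0 => t; rewrite hornerM; have [->|rt] := eqVneq r.[t] 0; first exact: mulr0.
  suff -> : q.[t] = 0 by rewrite mul0r.
  have Nuni : M + t *: M0 \in unitmx by rewrite unitmxE unitfE -rE.
  have NV : intertwines k (M + t *: M0).
    by apply/memv_intertwiners; rewrite memvD ?memvZ //; apply/memv_intertwiners.
  rewrite qE -(PX _ (X_Rep (affine_rep_Rep NV Nuni))); apply: mpoly.meval_eq => j.
  rewrite colM_affine_rep.
  rewrite addr0 linearD linearZ /=; congr (_ + _).
  by have /rowP/(_ j) := Mv; rewrite fE !mxE.
move/eqP: qr; rewrite mulf_eq0 (negPf r0) orbF => /eqP q0.
have := qE 0; rewrite q0 horner0 => e; rewrite [RHS]e; apply: mpoly.meval_eq => j.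
by rewrite mul0r addr0.
Qed.

(** Restricted to [H], a representation amounts to its lattice matrix modulo [U], the matrices that
    vanish on [H], so the dimension is that of the quotient. *)
Theorem rep_dim : rep R H = (\dim intertwiners - \dim U)%N.
Proof. exact: adimE rep_lower rep_upper. Qed.

End RepDimension.

(** * The rank of the collapsing equations *)

Section RankFormula.
Variables (R : realType) (k : crystal) (C : colored_graph k).
Implicit Types (M : 'M[R]_2) (g h : Gam k) (V : {set cvert C}) (E : {set cedge C}).
Local Notation rotR := (rotR R k).
Local Notation intertwiners := (intertwiners R k).
Local Notation config := ({ffun cvert C -> 'cV[R]_2} * 'M[R]_2)%type.

Definition edge_vec (e : cedge C) (x : config) : 'cV[R]_2 :=
  aff x.2 (color e) (x.1 (chead e)) - x.1 (ctail e).

Fact edge_vec_is_linear e : linear (edge_vec e).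
Proof.
by move=> a x y; rewrite /edge_vec !ffunE aff_linear scalerBr opprD addrACA.
Qed.
HB.instance Definition _ e := GRing.isLinear.Build R config 'cV[R]_2 *:%R (edge_vec e)
  (edge_vec_is_linear e).

Definition edge_fun e : 'Hom(config, 'cV[R]_2) := linfun (edge_vec e).

Definition configs : {vspace config} := (linfun snd @^-1: intertwiners)%VS.

Lemma memv_configs (x : config) : (x \in configs) = (x.2 \in intertwiners).
Proof. by rewrite -memv_preim lfunE. Qed.

Local Notation collapsing := (caps configs (kers configs edge_fun)).

Lemma collapsingP E (x : config) : reflect (intertwines k x.2 /\
  forall e, e \in E -> x.1 (ctail e) = aff x.2 (color e) (x.1 (chead e))) (x \in collapsing E).
Proof.
apply: (iffP (memv_kers _ _ _ _)) => -[Mx h].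
  split; first by apply/memv_intertwiners; rewrite -memv_configs.
  by move=> e /h; rewrite lfunE /= => /eqP; rewrite subr_eq0 => /eqP.
split; first by rewrite memv_configs; exact/memv_intertwiners.
by move=> e /h; rewrite lfunE /= /edge_vec => ->; rewrite subrr.
Qed.

Section Walks.
Variable E : {set cedge C}.

Lemma walk_trans a b c g h : walk_color E a b g -> walk_color E b c h ->
  walk_color E a c (g * h)%g.
Proof.
move=> w; elim: w h => [x|e y g' eE _ IH|e y g' eE _ IH] h wh.
- by rewrite mul1g.
- by rewrite -mulgA; apply: walk_forward => //; exact: IH.
- by rewrite -mulgA; apply: walk_backward => //; exact: IH.
Qed.

Lemma walk_edge e : e \in E -> walk_color E (ctail e) (chead e) (color e).
Proof.
by move=> eE; rewrite -[color e]mulg1; apply: walk_forward => //; exact: walk_nil.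
Qed.

Lemma walk_edgeV e : e \in E -> walk_color E (chead e) (ctail e) (color e)^-1%g.
Proof.
by move=> eE; rewrite -[(color e)^-1%g]mulg1; apply: walk_backward => //; exact: walk_nil.
Qed.

Lemma walk_sym a b g : walk_color E a b g -> walk_color E b a g^-1%g.
Proof.
elim=> [x|e y g' eE _ IH|e y g' eE _ IH]; first by rewrite invg1; exact: walk_nil.
  by rewrite invgM; apply: walk_trans IH _; exact: walk_edgeV.
by rewrite invgM invgK; apply: walk_trans IH _; exact: walk_edge.
Qed.

Lemma connect_walk a b : connect (adjacent E) a b -> exists g, walk_color E a b g.
Proof.
move=> /connectP[p]; elim: p a => [|c p IH] a /=; first by move=> _ ->; exists 1%g; exact: walk_nil.
move=> /andP[/exists_inP[e eE ac] /IH cp] /cp[g wg].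
have [h wh] : exists h, walk_color E a c h.
  case/orP: ac => /andP[/eqP <- /eqP <-]; last by exists (color e)^-1%g; exact: walk_edgeV.
  by exists (color e); exact: walk_edge.
by exists (h * g)%g; exact: walk_trans wg.
Qed.

Lemma adjacent_sym : symmetric (adjacent E).
Proof. by move=> x y; apply: eq_existsb => e; rewrite orbC. Qed.

Lemma root_walk a : exists g, walk_color E a (fingraph.root (adjacent E) a) g.
Proof. exact/connect_walk/connect_root. Qed.

Lemma root_edge e : e \in E -> fingraph.root (adjacent E) (ctail e) = fingraph.root (adjacent E) (chead e).
Proof.
move=> eE; apply/eqP; rewrite root_connect; last exact/sym_connect_sym/adjacent_sym.
by apply: connect1; apply/exists_inP; exists e; rewrite // !eqxx.
Qed.

Lemma walk_collapsing (x : config) a b g : x \in collapsing E -> walk_color E a b g ->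
  x.1 a = aff x.2 g (x.1 b).
Proof.
move=> /collapsingP[MA hE]; elim=> [y|e y g' eE _ IH|e y g' eE _ IH]; first by rewrite aff1.
  by rewrite affM // -IH hE.
by rewrite affM // -IH hE // affVK.
Qed.

Lemma rho_mul b g h : rho E b g -> rho E b h -> rho E b (g * h)%g.
Proof. exact: walk_trans. Qed.

Lemma rho_inv b g : rho E b g -> rho E b g^-1%g.
Proof. exact: walk_sym. Qed.

Lemma root_sub V a : is_subgraph V E -> a \in V -> fingraph.root (adjacent E) a \in V.
Proof.
move=> sub; have [g w] := root_walk a; elim: w => // e y g' eE _ IH _; apply: IH;
  by have [] := sub e eE.
Qed.

End Walks.

Definition rotates E b := `[< exists2 g, rho E b g & is_rotation g >].

Lemma T_rho E b : T_ (rho E b) = if rotates E b then 0%N else 2%N.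
Proof. by []. Qed.

Definition kills M (A : set (Gam k)) := forall g, A g -> M *m toR R g.1 = 0.

Lemma aff_killed M g q : M *m toR R g.1 = 0 -> g.2 = 0 -> aff M g q = q.
Proof. by move=> M0 g0; rewrite /aff M0 g0 expr0 add0r mul1mx. Qed.

Lemma aff_fixed M g q : aff M g q = q <-> (1%:M - rotR ^+ g.2) *m q = M *m toR R g.1.
Proof.
rewrite /aff mulmxBl mul1mx; split=> [e|<-]; last by rewrite subrK.
by rewrite -{1}e addrK.
Qed.

(* Modulo translations, on which [M] vanishes, the group of the component is
   cyclic, so the center of one rotation is fixed by all elements. *)
Lemma common_fixed_point M E b (y0 : 'cV[R]_2) : intertwines k M ->
  kills M (Lambda (rho E b)) ->
  exists2 y, (forall h, rho E b h -> aff M h y = y) & ~~ rotates E b -> y = y0.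
Proof.
move=> MA Mb; have [rot|/asboolPn rot] := boolP (rotates E b); last first.
  exists y0 => // h hb.
  have [h0|hr] := pselect (h.2 = 0); last by case: rot; exists h.
  by apply: aff_killed => //; exact: Mb.
move: (rot) => /asboolP[g gb gr]; have /(rotR_fixed_free R) u : g.2 != 0 by apply/eqP.
pose y := invmx (1%:M - rotR ^+ g.2) *m (M *m toR R g.1).
have gy : aff M g y = y by apply/aff_fixed; rewrite mulKVmx.
(* The commutator of [g] and [h] has no rotational part, so it acts trivially. Hence [h] sends [y]
   to a fixed point of [g], and [g] has only one. *)
exists y => // h hb; have ghy : aff M g (aff M h y) = aff M h y.
  have comm : aff M ((h * g)^-1 * (g * h))%g y = y.
    apply: aff_killed; last by rewrite /= addrC (addrC h.2) subrr.
    apply: Mb; split; last by rewrite /is_translation /= addrC (addrC h.2) subrr.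
    by apply: rho_mul; [apply: rho_inv|]; exact: rho_mul.
  by rewrite -{2}gy -!affM // -[in RHS]comm -affM // mulgA mulgV mul1g.
have /aff_fixed h1 := ghy; have /aff_fixed h2 := gy.
by apply: (can_inj (mulKmx u)); rewrite h1 h2.
Qed.

(** The positions left free once [M] is fixed and [E] is collapsed: a component is determined by its
    base vertex, which is pinned down as soon as the component carries a rotation. *)
Definition free_vertices V E : {set cvert C} :=
  [set x | (x \notin V) || ((x \in base_vertices V E) && ~~ rotates E x)].

Definition kill_base M V E := forall b, b \in base_vertices V E -> kills M (Lambda (rho E b)).

(** Positions are transported from the roots along chosen walks. The choice is harmless, because
    closed walks at a root fix its position by [common_fixed_point]. *)
Lemma collapsing_extend V E M (f : cvert C -> 'cV[R]_2) :
  is_subgraph V E -> M \in intertwiners -> kill_base M V E ->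
  exists2 q : {ffun cvert C -> 'cV[R]_2}, (q, M) \in collapsing E &
    forall x, x \in free_vertices V E -> q x = f x.
Proof.
move=> sub /memv_intertwiners MA MK.
have baseP x : x \in V -> fingraph.root (adjacent E) x \in base_vertices V E.
  move=> xV; rewrite inE root_sub //=; apply: roots_root.
  exact/sym_connect_sym/adjacent_sym.
have /choice[y hy] : forall b, exists y, b \in base_vertices V E ->
    (forall h, rho E b h -> aff M h y = y) /\ (~~ rotates E b -> y = f b).
  move=> b; case: (boolP (b \in base_vertices V E)) => bV; last by exists 0.
  by have [y y1 y2] := common_fixed_point (f b) MA (MK b bV); exists y.
have /choice[c hc] := root_walk E.
pose rt := fingraph.root (adjacent E).
exists [ffun x => if x \in V then aff M (c x) (y (rt x)) else f x].
  apply/collapsingP; split=> //= e eE; have [tV hV] := sub e eE.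
  have rE : rt (chead e) = rt (ctail e) by rewrite /rt (root_edge eE).
  rewrite !ffunE tV hV -affM // rE.
  have [fix_y _] := hy _ (baseP _ tV).
  have : rho E (rt (ctail e)) ((c (ctail e))^-1 * (color e * c (chead e)))%g.
    apply: walk_trans (walk_sym (hc _)) _; apply: walk_trans (walk_edge eE) _.
    by rewrite -rE.
  by move=> /fix_y fy; rewrite -[in LHS]fy -affM // mulgA mulgV mul1g.
move=> x; rewrite inE ffunE; case: (boolP (x \in V)) => //= xV /andP[xb nr].
have rx : rt x = x by move: xb; rewrite inE => /andP[_ /eqP].
have [fix_y yf] := hy x xb; rewrite rx fix_y ?yf //.
by have := hc x; rewrite -/(rt x) rx.
Qed.

Lemma collapsing_kill V E (x : config) : x \in collapsing E -> kill_base x.2 V E.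
Proof.
move=> xE b _ g [/(walk_collapsing xE) e g0].
by move/esym/aff_fixed : e => <-; rewrite g0 expr0 subrr mul0mx.
Qed.

Lemma collapsing_eq0 V E (x : config) : is_subgraph V E -> x \in collapsing E -> x.2 = 0 ->
  (forall v, v \in free_vertices V E -> x.1 v = 0) -> x = 0.
Proof.
move=> sub xE x2 xfree.
have aff0 g : aff x.2 g 0 = 0 by rewrite /aff x2 mul0mx mulmx0 addr0.
have base0 b : b \in base_vertices V E -> x.1 b = 0.
  move=> bb; case: (boolP (rotates E b)) => [/asboolP[g gb gr]|nr]; last first.
    by apply: xfree; rewrite inE bb nr orbT.
  have /(rotR_fixed_free R) u : g.2 != 0 by apply/eqP.
  have := walk_collapsing xE gb => /esym/aff_fixed; rewrite x2 mul0mx => e.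
  by rewrite -[LHS](mulKmx u) e mulmx0.
rewrite [x]surjective_pairing x2; congr pair; apply/ffunP => v; rewrite [RHS]ffunE.
case: (boolP (v \in V)) => vV; last by apply: xfree; rewrite inE vV.
have [g wg] := root_walk E v; rewrite (walk_collapsing xE wg) base0 ?aff0 //.
by rewrite inE root_sub //=; apply/roots_root/sym_connect_sym/adjacent_sym.
Qed.

(** The projection to [M] has image [U], since every [M] killing the translations of the components
    extends; its kernel is parametrized by arbitrary values on the free vertices. *)
Lemma dim_collapsing V E (U : {vspace 'M[R]_2}) : is_subgraph V E ->
  (forall M, (M \in U) <-> M \in intertwiners /\ kill_base M V E) ->
  \dim (collapsing E) = (\dim U + 2 * #|free_vertices V E|)%N.
Proof.
move=> sub memU; pose S := free_vertices V E.
have := limg_ker_dim (linfun (@snd {ffun cvert C -> 'cV[R]_2} 'M[R]_2)) (collapsing E).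
have -> : (linfun snd @: collapsing E)%VS = U.
  apply/vspaceP => M; apply/memv_imgP/idP => [[x xE ->]|MU].
    rewrite lfunE; apply/memU; split; last exact: collapsing_kill.
    by rewrite -memv_configs; apply: (subvP (capvSl _ _)) xE.
  have [MI MK] := (memU M).1 MU.
  have [q qE _] := collapsing_extend (fun=> 0) sub MI MK.
  by exists (q, M); rewrite // lfunE.
set L := (_ :&: _)%VS => <-; rewrite addnC; congr addn.
pose f (x : config) : {ffun {v | v \in S} -> 'cV[R]_2} := [ffun v => x.1 (val v)].
have f_lin : linear f by move=> a x y; apply/ffunP => v; rewrite !ffunE.
pose fL : {linear config -> {ffun {v | v \in S} -> 'cV[R]_2}} :=
  HB.pack f (GRing.isLinear.Build _ _ _ _ f f_lin).
have fE x : linfun fL x = f x by rewrite lfunE.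
have memL x : (x \in L) = (x \in collapsing E) && (x.2 == 0).
  by rewrite memv_cap memv_ker lfunE.
have ker0 : (L :&: lker (linfun fL) = 0)%VS.
  apply/eqP; rewrite -subv0; apply/subvP => x; rewrite memv_cap memL memv_ker fE memv0.
  move=> /andP[/andP[xE /eqP x2] /eqP/ffunP f0]; apply/eqP/(collapsing_eq0 sub xE x2) => v vS.
  by have := f0 (Sub v vS); rewrite !ffunE.
have full : (linfun fL @: L)%VS = fullv.
  apply/vspaceP => z; rewrite memvf; apply/memv_imgP.
  pose z' v := if insub v is Some v' then z v' else 0.
  have [||q qE qz] := @collapsing_extend V E 0 z' sub.
  - exact: mem0v.
  - by move=> b _ g _; rewrite mul0mx.
  exists (q, 0); first by rewrite memL qE eqxx.
  by rewrite fE; apply/ffunP => v; rewrite ffunE /= qz ?(valP v) // /z' valK.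
rewrite -(limg_dim_eq ker0) full dimvf.
rewrite (_ : dim _ = #|{: {v | v \in S}}| * 2)%N // card_sig mulnC.
by congr (_ * _)%N; apply: eq_card => v; rewrite !inE.
Qed.

Lemma dim_configs : \dim configs = (\dim intertwiners + 2 * #|cvert C|)%N.
Proof.
have := @dim_collapsing finset.set0 finset.set0 intertwiners.
rewrite (_ : caps _ _ _ = configs); last by rewrite /caps big_set0 capvf.
rewrite (_ : free_vertices _ _ = [set: cvert C]%SET); last by apply/setP => v; rewrite !inE.
rewrite cardsT; apply; first by move=> e; rewrite inE.
by move=> M; split=> [|[]//]; split=> // b; rewrite !inE.
Qed.

Lemma translation_kill_subgroup M : is_subgroup [set g : Gam k | g.2 = 0 /\ M *m toR R g.1 = 0].
Proof.
split; first by split=> //; rewrite /toR map_mx0 mulmx0.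
move=> g h [g0 gM] [h0 hM]; split; first by rewrite /= g0 h0 subrr.
have -> : (g * h^-1)%g.1 = g.1 - h.1.
  have hV : (h^-1)%g.1 = - (lattice_mx k ^+ (- h.2)%R *m h.1) by [].
  by rewrite Gam_mul1E hV g0 h0 oppr0 !expr0 !mul1mx.
by rewrite /toR map_mxD map_mxN mulmxDr mulmxN -!/(toR R _) gM hM subrr.
Qed.

(** Collapsing removes two dimensions for each vertex of [V] other than the base of a component
    without rotations, and [rep_graph] dimensions of lattice matrices. The right side does not
    mention [V]: an isolated vertex adds 2 to the vertex term and 2 to the sum of the [T_]. *)
Theorem laman_f_rank V E : is_subgraph V E ->
  laman_f R V E = (\dim configs)%:Z - (\dim (collapsing E))%:Z.
Proof.
move=> sub.
have [|a M N [MI MK] [NI NK]|U memU] := @vspace_of_pred R 'M[R]_2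
    (fun M => M \in intertwiners /\ kill_base M V E).
- by split; [exact: mem0v|move=> b _ g _; rewrite mul0mx].
- split; first by rewrite memvD ?memvZ.
  by move=> b bb g gb; rewrite mulmxDl -scalemxAl (MK b bb g gb) (NK b bb g gb) scaler0 addr0.
have UI : (U <= intertwiners)%VS by apply/subvP => M /memU[].
have repE : rep_graph R V E = (\dim intertwiners - \dim U)%N.
  apply: rep_dim.
  - move=> h /(_ [set g | g.2 = 0 /\ (0 : 'M[R]_2) *m toR R g.1 = 0]) [] //.
    split; first exact: translation_kill_subgroup.
    by move=> g [b _ [_ g0]]; split=> //; rewrite mul0mx.
  - by move=> A [[A1 _] _].
  move=> M; split=> [/memU[MI MK]|[MI MK]].
    split=> // h /(_ [set g | g.2 = 0 /\ M *m toR R g.1 = 0]) [] //.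
    split; first exact: translation_kill_subgroup.
    by move=> g [b bb [gb g0]]; split=> //; exact: (MK b bb).
  apply/memU; split=> // b bb g gb; apply: MK => A [_]; apply; by exists b.
rewrite /laman_f repE dim_configs (dim_collapsing sub memU).
have -> : (\sum_(b in base_vertices V E) T_ (rho E b) =
    2 * #|[set b in base_vertices V E | ~~ rotates E b]%SET|)%N.
  rewrite -sum1_card big_distrr /= [RHS](eq_bigl (fun b => (b \in base_vertices V E) && ~~ rotates E b)).
    by rewrite big_mkcondr; apply: eq_bigr => b _; rewrite T_rho; case: rotates.
  by move=> b; rewrite inE.
have -> : free_vertices V E = (~: V :|: [set b in base_vertices V E | ~~ rotates E b])%SET.
  by apply/setP => v; rewrite !inE.
set W := [set b in _ | _]%SET.
have dW : (~: V :&: W)%SET = finset.set0.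
  apply/setP => v; rewrite !inE; case: (v \in V) => //=.
have := cardsUI (~: V)%SET W; have := cardsC V; have := dimvS UI.
by rewrite dW cards0; lia.
Qed.

End RankFormula.

(** * Realizations as solutions of a finite linear system *)

Section TrivialConfigs.
Variables (R : realType) (k : crystal) (C : colored_graph k).
Local Notation rotR := (rotR R k).
Local Notation config := ({ffun cvert C -> 'cV[R]_2} * 'M[R]_2)%type.

(** The translations that commute with the rotation: all of them for order 1, only 0 otherwise. They
    are the ones that normalizing the rotation center to the origin leaves undetermined. *)
Definition fixed_vectors : {vspace 'cV[R]_2} :=
  lker (linfun (mulmx (1%:M - rotR))).

Lemma memv_fixed_vectors c : (c \in fixed_vectors) <-> rotR *m c = c.
Proof.
rewrite memv_ker lfunE /= mulmxBl mul1mx subr_eq0; split; first by move/eqP.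
by move=> ->.
Qed.

Lemma fixed_vectorsX c n : c \in fixed_vectors -> rotR ^+ n *m c = c.
Proof.
move=> /memv_fixed_vectors Rc; elim: n => [|n IH]; first by rewrite expr0 mul1mx.
by rewrite exprS -mulmxE -mulmxA IH.
Qed.

Lemma dim_fixed_vectors : \dim fixed_vectors = T_ [set: Gam k].
Proof.
rewrite /T_; have [s0|s0] := eqVneq (inZp 1 : 'I_(order_of k).-1.+1) 0.
  case: asboolP => [[g _ gr]|_].
    case: gr; apply: val_inj; have := congr1 val s0; rewrite /=; case: (g.2) => n /=.
    by case: (k) => //=; case: n.
  have -> : fixed_vectors = fullv.
    apply/vspaceP => c; rewrite memvf; apply/memv_fixed_vectors.
    by have := rotR_inZp R k 1; rewrite s0 expr0 expr1 => <-; rewrite mul1mx.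
  by rewrite dimvf dim_matrix.
case: asboolP => [_|[]]; last by exists (r_ k) => //; apply/eqP.
apply/eqP; rewrite dimv_eq0 -subv0; apply/subvP => c; rewrite memv_ker lfunE memv0 /=.
have := rotR_fixed_free R s0; rewrite rotR_inZp expr1 => u /eqP e.
by rewrite -(mulKmx u c) e mulmx0.
Qed.

Definition const_config (c : 'cV[R]_2) : config := ([ffun=> c], 0).

Fact const_config_is_linear : linear const_config.
Proof.
move=> a b c; congr pair; first by apply/ffunP => v; rewrite !ffunE.
by rewrite [RHS]/= scaler0 addr0.
Qed.
HB.instance Definition _ := GRing.isLinear.Build R 'cV[R]_2 config *:%R const_config
  const_config_is_linear.

Definition trivial_configs : {vspace config} := (linfun const_config @: fixed_vectors)%VS.

Lemma trivial_configsP (x : config) :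
  reflect (exists2 c, rotR *m c = c & x = const_config c) (x \in trivial_configs).
Proof.
apply: (iffP memv_imgP) => -[c cF ->]; exists c; rewrite ?lfunE //.
  exact/memv_fixed_vectors.
exact/memv_fixed_vectors.
Qed.

Lemma dim_trivial_configs (v : cvert C) : \dim trivial_configs = T_ [set: Gam k].
Proof.
rewrite -dim_fixed_vectors limg_dim_eq //; apply/eqP; rewrite -subv0.
apply/subvP => c; rewrite memv_cap memv_ker lfunE memv0 => /andP[_ /eqP /(congr1 fst)].
by move=> /ffunP/(_ v); rewrite !ffunE => ->.
Qed.

Lemma trivial_configs_sub E : (trivial_configs <= caps (configs R C) (kers (configs R C) (@edge_fun R k C)) E)%VS.
Proof.
apply/subvP => x /trivial_configsP[c /memv_fixed_vectors Rc ->]; apply/collapsingP; split.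
  by apply/memv_intertwiners; exact: mem0v.
by move=> e _; rewrite /aff /= !ffunE mul0mx add0r fixed_vectorsX.
Qed.

Definition faithful_sol (z : cedge C * 'I_2 -> R) (x : config) :=
  [/\ x \in configs R C, x \in sol (@edge_fun R k C) [set: cedge C]%SET z,
    forall e, edge_vec e x != 0 & x.2 != 0].

Definition unique_sol z := exists x, faithful_sol z x /\
  forall x', faithful_sol z x' -> exists2 a, a != 0 & x' - a *: x \in trivial_configs.

End TrivialConfigs.

(** * Passage between infinite realizations and finite configurations *)

Section Realizations.
Variables (R : realType) (k : crystal) (G : sym_graph k) (C : colored_graph k).
Variables (vrep : cvert C -> gvert G) (erep : cedge C -> gedge G).
Hypothesis hC : associated vrep erep.
Variable d : gedge G -> 'cV[R]_2.
Hypothesis hd : is_direction_network d.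
Implicit Types (p : gvert G -> 'cV[R]_2) (Phi : Gam k -> euc R) (M : 'M[R]_2) (c : 'cV[R]_2).
Local Notation rotR := (rotR R k).
Local Notation config := ({ffun cvert C -> 'cV[R]_2} * 'M[R]_2)%type.

Definition dir_coords (ei : cedge C * 'I_2) : R := d (erep ei.1) ei.2 0.

Lemma dirs_dir_coords e : dirs dir_coords e = d (erep e).
Proof. by apply/matrixP => i j; rewrite mxE (ord1 j). Qed.

Definition edge_diff p e := p (gends e).2 - p (gends e).1.

(** The ends of an edge are listed in no particular order, so differences are known only up to sign,
    which neither parallelism nor collapse can detect. *)
Definition equal_up_to_sign (u w : 'cV[R]_2) := u = w \/ u = - w.

Lemma same_ends_diff p a b : same_ends a b ->
  equal_up_to_sign (p a.2 - p a.1) (p b.2 - p b.1).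
Proof. by case=> ->; [left|right; rewrite opprB]. Qed.

Lemma vact_action : is_action (@vact k G). Proof. by case: G. Qed.
Lemma vact_free : free_action (@vact k G). Proof. by case: G. Qed.
Lemma eact_ends g e : same_ends (gends (@eact k G g e)) (vact g (gends e).1, vact g (gends e).2).
Proof. by case: G e. Qed.

Lemma edge_diff_eact p M c g e :
  (forall g y, p (vact g y) = eapp (affine_rep M c g) (p y)) ->
  equal_up_to_sign (edge_diff p (eact g e)) (rotR ^+ g.2 *m edge_diff p e).
Proof.
move=> hp; have := same_ends_diff p (eact_ends g e); rewrite /= !hp !eapp_affine_rep.
by rewrite opprD addrACA subrr addr0 affB subrr /aff mul0mx add0r opprB addrA subrK.
Qed.

Lemma edge_diff_erep p M c e :
  (forall g y, p (vact g y) = eapp (affine_rep M c g) (p y)) ->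
  equal_up_to_sign (edge_diff p (erep e)) (edge_vec e ([ffun i => p (vrep i) - c], M)).
Proof.
move=> hp; have [_ _ hE] := hC; have := same_ends_diff p (hE e).
by rewrite /= hp eapp_affine_rep /edge_vec /= !ffunE opprB addrA addrAC.
Qed.

Lemma vrep_decomp y : exists ig : cvert C * Gam k, y = vact ig.2 (vrep ig.1).
Proof. by have [hV _ _] := hC; have [i [[g e] _]] := hV y; exists (i, g). Qed.

Lemma erep_decomp e : exists ig : cedge C * Gam k, e = eact ig.2 (erep ig.1).
Proof. by have [_ hE _] := hC; have [i [[g h] _]] := hE e; exists (i, g). Qed.

Lemma vrep_inj g h i j : vact g (vrep i) = vact h (vrep j) -> i = j /\ g = h.
Proof.
have [act1 actM] := vact_action; move=> e; have ij : i = j.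
  have [hV _ _] := hC; have [a [_ ua]] := hV (vact g (vrep i)).
  by rewrite -(ua i) ?(ua j) //; [exists h|exists g].
split=> //; apply: (mulgI h^-1%g); rewrite mulVg; apply: (@vact_free _ (vrep j)).
by rewrite actM -ij e -ij -actM mulVg act1.
Qed.

Lemma faithful_restrict p M c : intertwines k M ->
  is_faithful_realization d p (affine_rep M c) ->
  faithful_sol dir_coords ([ffun i => p (vrep i) - c], M).
Proof.
move=> MA [[_ he hp] hcol htr]; split.
- by rewrite memv_configs; exact/memv_intertwiners.
- apply/memv_sol => e _; rewrite dirs_dir_coords lfunE /dperp.
  have := he (erep e); rewrite -/(edge_diff p _).
  by case: (edge_diff_erep e hp) => -> //; rewrite -!/(dperp _ _) linearN => /eqP;
    rewrite oppr_eq0 => /eqP.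
- move=> e; apply/eqP => e0; apply: (hcol (erep e)); apply/esym/eqP.
  rewrite -subr_eq0 -/(edge_diff p _).
  by case: (edge_diff_erep e hp) => ->; rewrite e0 ?oppr0.
by apply/eqP => /= M0; apply: htr; exact/affine_rep_trivial.
Qed.

Lemma faithful_extend (x : config) : faithful_sol dir_coords x ->
  exists p, is_faithful_realization d p (affine_rep x.2 0) /\
    forall g i, p (vact g (vrep i)) = aff x.2 g (x.1 i).
Proof.
move=> [xc /memv_sol xs xe x2]; have /choice[ig hig] := vrep_decomp.
have MA : intertwines k x.2 by apply/memv_intertwiners; rewrite -memv_configs.
have [act1 actM] := vact_action.
exists (fun y => aff x.2 (ig y).2 (x.1 (ig y).1)).
set p := fun y => _.
have pE g i : p (vact g (vrep i)) = aff x.2 g (x.1 i).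
  by rewrite /p; have [<- <-] := vrep_inj (hig (vact g (vrep i))).
have hp g y : p (vact g y) = eapp (affine_rep x.2 0 g) (p y).
  by rewrite eapp_affine_rep subr0 addr0 (hig y) -actM !pE affM.
have xE : ([ffun i => p (vrep i) - 0], x.2) = x.
  rewrite [RHS]surjective_pairing; congr pair; apply/ffunP => i.
  by rewrite ffunE subr0 -[vrep i]act1 pE aff1.
have diff_erep e : equal_up_to_sign (edge_diff p (erep e)) (edge_vec e x).
  by have := edge_diff_erep e hp; rewrite xE.
split=> //; split.
- split=> //; first exact: affine_rep_bar.
  move=> e; have [[e0 g] /= ->] := erep_decomp e; rewrite (hd.2 g) rot_partE.
  rewrite -/(edge_diff p _) -/(dperp _ _).
  suff h : dperp (d (erep e0)) (edge_diff p (erep e0)) = 0.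
    by case: (edge_diff_eact g (erep e0) hp) => ->; rewrite ?dperpN dperp_rotR h ?oppr0.
  have h : dperp (d (erep e0)) (edge_vec e0 x) = 0.
    by have := xs e0 (finset.in_setT e0); rewrite dirs_dir_coords lfunE.
  by case: (diff_erep e0) => ->; rewrite ?dperpN h ?oppr0.
- move=> e; have [[e0 g] /= ->] := erep_decomp e => /esym/eqP.
  rewrite -subr_eq0 -/(edge_diff p _).
  have n0 : edge_diff p (erep e0) != 0 by case: (diff_erep e0) => ->; rewrite ?oppr_eq0.
  have n1 : rotR ^+ g.2 *m edge_diff p (erep e0) != 0.
    apply: contra n0 => /eqP e1; have := rotR_orth R k g.2 => o.
    by rewrite -[edge_diff _ _]mul1mx -o -mulmxA e1 mulmx0.
  by case: (edge_diff_eact g (erep e0) hp) => ->; rewrite ?oppr_eq0; apply/negP.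
by move/affine_rep_trivial/eqP; exact/negP.
Qed.

Lemma eapp_t_ M c j y : eapp (affine_rep M c (t_ k j)) y = M *m delta_mx j 0 + y.
Proof.
by rewrite eapp_affine_rep /aff expr0 mul1mx /toR map_delta_mx -addrA subrK.
Qed.

Lemma eapp_r_ M c y : eapp (affine_rep M c (r_ k)) y = rotR *m (y - c) + c.
Proof.
by rewrite eapp_affine_rep /aff /toR map_mx0 mulmx0 add0r rotR_inZp expr1.
Qed.

(** Restricting to representatives and recentering at the rotation center turns realizations into
    configurations; the freedom of scaling and translating becomes scaling modulo
    [trivial_configs]. *)
Lemma has_uniqueE : has_unique_faithful_realization d <-> unique_sol dir_coords.
Proof.
split=> [[p [Phi [hf uniq]]]|[x [hx uniq]]].
  have [[/rep_bar_affine[M [c [MA PhiE]]] _ _] _ _] := hf; subst Phi.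
  exists ([ffun i => p (vrep i) - c], M); split; first exact: faithful_restrict.
  move=> x' hx'; have [p' [hf' p'E]] := faithful_extend hx'.
  have [a [u [a0 pu Phiu]]] := uniq _ _ hf'; exists a; first exact/eqP.
  have M'E : x'.2 = a *: M.
    apply/matrixP => i j; have := Phiu (t_ k j) 0.
    rewrite !eapp_t_ scaler0 add0r addr0 => /addIr.
    by rewrite -!colE => /matrixP/(_ i 0); rewrite !mxE.
  (* The map [a x + u] sends the center [c] of the first realization to a point fixed by the
     generator of the second, whose center is the origin. So this vector is fixed by the
     rotation. *)
  apply/trivial_configsP; exists (u + a *: c).
    have := Phiu (r_ k) c; rewrite !eapp_r_ subrr mulmx0 add0r subr0 addr0.
    by rewrite addrC.
  rewrite [LHS]surjective_pairing; congr pair; last by rewrite /= M'E subrr.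
  apply/ffunP => i; rewrite !ffunE /=; have [act1 _] := vact_action.
  have := pu (vrep i); rewrite -{1}[vrep i]act1 p'E aff1 => ->.
  rewrite scalerBr opprB; move: (a *: p (vrep i)) (a *: c) => y z.
  by rewrite (addrC y u) -addrA; congr (u + _); rewrite addrCA subrr addr0.
have [p [hf pE]] := faithful_extend hx; exists p, (affine_rep x.2 0); split=> //.
move=> p' Phi' hf'; have [[/rep_bar_affine[M' [c' [MA' PhiE]]] _ hp'] _ _] := hf'; subst Phi'.
have [a a0 /trivial_configsP[z Rz xE]] := uniq _ (faithful_restrict MA' hf').
have M'E : M' = a *: x.2 by have /(congr1 snd)/eqP := xE; rewrite /= subr_eq0 => /eqP.
have qE i : p' (vrep i) - c' = a *: x.1 i + z.
  have /(congr1 fst)/ffunP/(_ i) := xE; rewrite !ffunE /= => <-.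
  by rewrite [RHS]addrC subrK.
have affE (g : Gam k) y : aff M' g (a *: y + z) = a *: aff x.2 g y + z.
  rewrite M'E -[a *: x.2]addr0 aff_linear; congr (_ + _).
  have zF : z \in fixed_vectors R k by apply/memv_fixed_vectors.
  by rewrite /aff mul0mx add0r fixed_vectorsX.
exists a, (z + c') => psi; split; first exact/eqP.
  move=> y; have [[i g] /= ->] := vrep_decomp y.
  by rewrite hp' eapp_affine_rep qE affE pE /psi addrA.
move=> g y; rewrite !eapp_affine_rep /psi subr0 addr0 (addrA (a *: y)) addrK affE.
by rewrite addrA.
Qed.

End Realizations.

(** * Colored-Laman graphs *)

Section Laman.
Variables (R : realType) (k : crystal) (C : colored_graph k) (v0 : cvert C).
Implicit Types (F : {set cedge C}) (x : cedge C * 'I_2 -> R).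
Local Notation config := ({ffun cvert C -> 'cV[R]_2} * 'M[R]_2)%type.
Local Notation X0 := (configs R C).
Local Notation ef := (@edge_fun R k C).
Local Notation collapsing := (caps X0 (kers X0 ef)).
Local Notation T := (T_ [set: Gam k]).
Local Notation Triv := (trivial_configs R C).
Local Notation Sol x := (X0 :&: sol ef [set: cedge C]%SET x)%VS.

(** By [laman_f_rank] this is the subgraph condition of colored-Laman graphs. Only edge sets are
    quantified, because the rank does not see isolated vertices. *)
Definition sparse := forall F, F != finset.set0 -> (#|F|.+1 + \dim (collapsing F) <= \dim X0)%N.

Lemma rep_translations : rep R (Lambda [set: Gam k]) = \dim (intertwiners R k).
Proof.
rewrite (@rep_dim R k _ 0%VS) ?dimv0 ?subn0 //; first by move=> h [].
move=> M; rewrite memv0; split=> [/eqP ->|[_ MK]].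
  by split=> [|h _]; [exact: mem0v|rewrite mul0mx].
apply/eqP/matrixP => i j; have := MK (transl k (delta_mx j 0)) (conj I erefl).
by rewrite /toR map_delta_mx -colE => /matrixP/(_ i 0); rewrite !mxE.
Qed.

Lemma colored_lamanE : colored_laman R C <-> (#|cedge C|.+1 + T = \dim X0)%N /\ sparse.
Proof.
have eqm : #|cedge C|%:Z = (2 * #|cvert C| + rep R (Lambda [set: Gam k]))%:Z
    - (T)%:Z - 1 <-> (#|cedge C|.+1 + T = \dim X0)%N.
  by rewrite rep_translations dim_configs; split=> e; lia.
rewrite /colored_laman; split=> -[/eqm em sp]; split=> //.
  move=> F F0; have subF : @is_subgraph k C [set: cvert C]%SET F by move=> e _; rewrite !finset.in_setT.
  have := sp _ F subF; rewrite card_gt0 F0 => /(_ isT).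
  by rewrite /laman_h (laman_f_rank R subF); lia.
move=> V F subF; rewrite card_gt0 => F0; have := sp F F0.
by rewrite /laman_h (laman_f_rank R subF); lia.
Qed.

Lemma dim_intertwiners_gt0 : (0 < \dim (intertwiners R k))%N.
Proof.
have [M MA uM] := intertwiner_exists R k; rewrite lt0n dimv_eq0; apply/eqP => I0.
have : M \in intertwiners R k by exact/memv_intertwiners.
by rewrite I0 memv0 => /eqP M0; move: uM; rewrite M0 unitmxE det0 unitr0.
Qed.

Lemma T_le2 : (T <= 2)%N.
Proof. by rewrite /T_; case: asboolP. Qed.

Lemma collapsing0 : collapsing finset.set0 = X0.
Proof. by rewrite /caps big_set0 capvf. Qed.

Definition no_lattice : {vspace config} := (X0 :&: lker (linfun snd))%VS.

Lemma memv_no_lattice (y : config) : (y \in no_lattice) = (y.2 == 0).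
Proof.
rewrite memv_cap memv_ker lfunE memv_configs /=.
by case: eqP => [->|]; rewrite ?mem0v ?andbF.
Qed.

Lemma trivial_configs_sol x : (Triv <= Sol x)%VS.
Proof. exact: subv_trans (trivial_configs_sub R _) (kers_sub_sol _ _ _ _). Qed.

(** The extra unit in [sparse] leaves room in Rado's condition for [K]. The resulting hyperplane
    cuts the solutions down to dimension [T], hence to the trivial ones; as it lowers the dimension
    by at most 1, the second bound follows. *)
Lemma generic_sol_trivial (K : {vspace config}) :
  (#|cedge C|.+1 + T = \dim X0)%N -> sparse -> (K <= X0)%VS -> (Triv <= K)%VS ->
  (\dim K < \dim X0)%N ->
  generic (fun x => (Sol x :&: K <= Triv)%VS /\ (\dim (Sol x) <= T.+1)%N).
Proof.
move=> em sp KX TK dK.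
have rad F : (#|F| + \dim (collapsing F) <= \dim X0)%N.
  have [->|F0] := eqVneq F finset.set0; first by rewrite cards0 collapsing0.
  by have := sp F F0; lia.
have rad1 F : (#|F|.+1 + \dim (collapsing F :&: K) <= \dim X0)%N.
  have [->|F0] := eqVneq F finset.set0.
    by rewrite cards0 collapsing0 (capv_idPr KX).
  by have := sp F F0; have := dimvS (capvSl (collapsing F) K); lia.
have [H [KH dH]] := generic_rank1 KX rad rad1.
apply: generic_sub => x gx.
have dT := dim_trivial_configs R v0.
have dSH : (\dim (Sol x :&: H) <= T)%N by move: gx; rewrite -em leq_add2l.
have TS := trivial_configs_sol x.
have TH : (Triv <= Sol x :&: H)%VS by rewrite subv_cap TS (subv_trans TK).
have /eqP SHE : Triv == (Sol x :&: H)%VS by rewrite eqEdim TH dT.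
split; first by rewrite SHE capvS ?subvv.
have SXH : (Sol x :&: (X0 :&: H) = Sol x :&: H)%VS.
  by rewrite capvA (capv_idPl (capvSl _ _)).
have le : (Sol x + X0 :&: H <= X0)%VS by rewrite subv_add !capvSl.
rewrite -(leq_add2r (\dim (X0 :&: H))) -dimv_sum_cap SXH.
by apply: leq_trans (leq_add (dimvS le) dSH) _; rewrite addSnnS addnC leq_add2l.
Qed.

Lemma trivial_config_lattice (y : config) : y \in Triv -> y.2 = 0.
Proof. by move=> /trivial_configsP[c _ ->]. Qed.

Lemma trivial_config_edge (y : config) e : y \in Triv -> edge_vec e y = 0.
Proof.
move=> /(subvP (trivial_configs_sub R [set: cedge C]%SET)) /memv_kers[_ h].
by have := h e (finset.in_setT e); rewrite lfunE.
Qed.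

(** Each [K o] is a space of unwanted configurations: one edge collapsed, or a zero lattice part for
    [None]. Generically the solutions are the trivial ones plus one line spanned outside all of
    these. *)
Lemma laman_unique : (#|cedge C|.+1 + T = \dim X0)%N -> sparse -> generic (@unique_sol R k C).
Proof.
move=> em sp; have dT := dim_trivial_configs R v0.
pose K (o : option (cedge C)) := if o is Some e then kers X0 ef e else no_lattice.
have KX o : (K o <= X0)%VS by case: o => [e|]; exact: capvSl.
have TX : (Triv <= X0)%VS by rewrite -collapsing0 trivial_configs_sub.
have TK o : (Triv <= K o)%VS.
  apply/subvP => y yT; case: o => [e|] /=.
    by rewrite memv_cap (subvP TX) //= memv_ker lfunE /= trivial_config_edge.
  by rewrite memv_no_lattice trivial_config_lattice.
have dK o : (\dim (K o) < \dim X0)%N.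
  case: o => [e|] /=.
    have := sp [set e]%SET; rewrite -card_gt0 cards1 => /(_ isT).
    suff -> : collapsing [set e]%SET = kers X0 ef e by lia.
    by rewrite /caps finset.big_set1 (capv_idPr (capvSl _ _)).
  rewrite ltn_neqAle dimvS ?capvSl // andbT; apply/negP => /eqP dE.
  have /eqP E : no_lattice == X0 by rewrite eqEdim capvSl dE leqnn.
  have [M MA uM] := intertwiner_exists R k.
  have : ((0, M) : config) \in X0 by rewrite memv_configs; exact/memv_intertwiners.
  rewrite -E memv_no_lattice => /eqP /= M0.
  by move: uM; rewrite M0 unitmxE det0 unitr0.
have := generic_forall (fun o => generic_sol_trivial em sp (KX o) (TK o) (dK o)).
apply: generic_sub => x gx.
have dS : \dim (Sol x) = T.+1.
  have [_ le] := gx None; apply/eqP; rewrite eqn_leq le /=.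
  by have := dim_sol X0 ef [set: cedge C]%SET x; rewrite cardsT -em addSnnS leq_add2l.
have TS := trivial_configs_sol x.
have /subvPn[y yS yT] : ~~ (Sol x <= Triv)%VS.
  by apply/negP => /dimvS; rewrite dS dT ltnn.
have notK o : y \notin K o.
  by apply: contra yT => yK; apply: (subvP (gx o).1); rewrite memv_cap yS.
have [yX ys] := memv_capP yS.
exists y; split.
  split=> // [e|]; last by have := notK None; rewrite memv_no_lattice.
  by have := notK (Some e); rewrite memv_cap yX memv_ker lfunE.
move=> z [zX zs _ z2].
have zTy : z \in (Triv + <[y]>)%VS.
  suff /eqP -> : (Triv + <[y]> == Sol x)%VS by rewrite memv_cap zX.
  rewrite eqEdim subv_add TS -memvE yS dS /= -dT.
  rewrite ltn_neqAle dimvS ?addvSl // andbT; apply: contra yT => /eqP e.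
  have /eqP -> : Triv == (Triv + <[y]>)%VS by rewrite eqEdim addvSl e leqnn.
  by rewrite memvE addvSr.
have /memv_addP[t tT [_ /vlineP[a ->] zE]] := zTy.
exists a; last by rewrite zE addrK.
apply: contra z2 => /eqP a0; apply/eqP/trivial_config_lattice.
by rewrite zE a0 scale0r addr0.
Qed.

(* A minimal violation of sparsity is tight, so generic directions on it force
   all its edges to collapse. *)
Lemma not_sparse_collapsed : ~ sparse -> generic (fun x => forall y, ~ faithful_sol x y).
Proof.
pose bad F := (F != finset.set0) && (\dim X0 < #|F|.+1 + \dim (collapsing F))%N.
move=> nsp; have [F0 badF0] : exists F, bad F.
  apply: contrapT => /forallNP h; apply: nsp => F Fn0; rewrite leqNgt; apply/negP => lt.
  by apply: (h F); rewrite /bad Fn0.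
have [F /minsetP[/andP[Fn0 tight] minF] _] := minset_exists badF0.
have [e eF] := set0Pn _ Fn0.
have collapse x y : y \in Sol x -> y \in collapsing F -> ~ faithful_sol x y.
  by move=> _ /memv_kers[_ h] [_ _ /(_ e)]; have := h e eF; rewrite lfunE /= => ->; rewrite eqxx.
have KX : (collapsing F <= X0)%VS := caps_sub _ _ _.
(* Edges that collapse in every configuration, such as a loop of trivial color, need no
   genericity. *)
have [KE|KE] := eqVneq (collapsing F) X0.
  apply: generic_all => x y fy; apply: (collapse x y) (fy); have [yX ys _ _] := fy.
    by rewrite memv_cap yX.
  by rewrite KE.
have smaller F' : F' \subset F -> F' != F -> F' != finset.set0 ->
    (#|F'|.+1 + \dim (collapsing F') <= \dim X0)%N.
  move=> sF neF F'0; rewrite leqNgt; apply/negP => lt; case/eqP: neF; apply: minF => //.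
  by rewrite /bad F'0.
have radF : rado X0 F (kers X0 ef).
  move=> F' sF; have [->|F'0] := eqVneq F' finset.set0; first by rewrite cards0 collapsing0.
  have [->|neF] := eqVneq F' F; last by exact/ltnW/smaller.
  (* For [F] itself, the unit of slack in the inequality for [F :\ e] pays for the edge [e]. If [e]
     is the only edge, the properness in [KE] does. *)
  have [Fe0|Fe0] := eqVneq (F :\ e) finset.set0.
    rewrite (cardsD1 e) eF Fe0 cards0 /= ltn_neqAle dimvS // andbT.
    by apply: contra KE => /eqP dE; rewrite eqEdim KX dE leqnn.
  have neFe : F :\ e != F by apply/eqP => E; have := eF; rewrite -E !inE eqxx.
  have := smaller _ (finset.subsetDl _ _) neFe Fe0.
  have := dimvS (kersS X0 ef (finset.subsetDl F [set e]%SET)).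
  rewrite (cardsD1 e F) eF add1n => le; apply: leq_trans.
  by rewrite leq_add2l.
apply: generic_sub (generic_rank radF) => x gx y fy; have [yX ys _ _] := fy.
apply: (collapse x y) (fy); first by rewrite memv_cap yX.
have /eqP -> : collapsing F == (X0 :&: sol ef F x)%VS.
  rewrite eqEdim kers_sub_sol /= -(leq_add2l #|F|).
  by apply: leq_trans gx _; rewrite -ltnS -addSn.
rewrite memv_cap yX; apply/memv_sol => e' _; move/memv_sol: ys; apply; exact: finset.in_setT.
Qed.

Lemma nonroot_exists (q : {poly R}) : q != 0 -> exists t, q.[t] != 0.
Proof.
move=> q0; apply: contrapT => /forallNP h; case/eqP: q0; apply: poly_fun_eq0 => t.
by apply/eqP/negPn/negP/h.
Qed.

(* With too few edges there is a second direction [y] in the solution space, and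
   [x + t y] stays faithful for all but finitely many [t]. *)
Lemma sparse_not_unique : (#|cedge C|.+1 + T <> \dim X0)%N -> sparse ->
  forall x, ~ unique_sol x.
Proof.
move=> nem sp x [y [[yX ys ye y2] uniq]]; have dT := dim_trivial_configs R v0.
have lt : (#|cedge C|.+2 + T <= \dim X0)%N.
  suff : (#|cedge C|.+1 + T <= \dim X0)%N by lia.
  (* Without edges [sparse] says nothing; the bound then comes from the two coordinates of a vertex
     and one dimension of intertwiners. *)
  have [E0|E0] := eqVneq [set: cedge C]%SET finset.set0.
    have := cardsT (cedge C); rewrite E0 cards0 => <-.
    have n0 : (0 < #|cvert C|)%N by apply/card_gt0P; exists v0.
    by rewrite dim_configs; have := T_le2; have := dim_intertwiners_gt0; lia.
  have := sp _ E0; have := dimvS (trivial_configs_sub R [set: cedge C]%SET).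
  by rewrite dT cardsT; lia.
have /subvPn[z zS zT] : ~~ (Sol x <= Triv + <[y]>)%VS.
  have dTy : (\dim (Triv + <[y]>) <= T.+1)%N.
    apply: leq_trans (dimv_add_leqif Triv <[y]>).1 _.
    by rewrite dT dim_vline; case: (y != 0); rewrite /= ?addn1 ?addn0.
  apply/negP => /dimvS le; have := leq_trans lt (dim_sol X0 ef [set: cedge C]%SET x).
  rewrite cardsT addSnnS addSnnS leq_add2l => le2.
  by have := leq_trans le2 (leq_trans le dTy); rewrite ltnn.
have [zX zs] := memv_capP zS.
have /choice[c hc] : forall e, exists i, edge_vec e y i 0 != 0.
  move=> e; apply: contrapT => /forallNP h; case/eqP: (ye e); apply/matrixP => i j.
  by rewrite (ord1 j) [RHS]mxE; apply/eqP/negPn/negP/h.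
have [a [b y2ab]] : exists a b, y.2 a b != 0.
  apply: contrapT => h; case/eqP: y2; apply/matrixP => a b; rewrite [RHS]mxE.
  by apply/eqP/negPn/negP => ne; apply: h; exists a, b.
pose lin (u w : R) : {poly R} := u%:P + w *: 'X.
have linE u w t : (lin u w).[t] = u + t * w by rewrite !hornerE mulrC.
have lin0 u w : u != 0 -> lin u w != 0.
  by apply: contra => /eqP l0; have := linE u w 0; rewrite l0 horner0 mul0r addr0 => <-.
(* At a nonroot [t], the factors ensure in turn that [t] is nonzero, that the lattice part is
   nonzero and that no edge is collapsed. *)
pose q := 'X * lin (y.2 a b) (z.2 a b) *
  \prod_e lin (edge_vec e y (c e) 0) (edge_vec e z (c e) 0).
have [|t] := @nonroot_exists q.
  rewrite !mulf_neq0 ?polyX_eq0 ?lin0 //; apply/prodf_neq0 => e _; exact: lin0.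
rewrite !hornerM hornerX horner_prod linE !mulf_eq0 !negb_or => /andP[/andP[t0 ht2] /prodf_neq0 hte].
have [|s s0] := uniq (y + t *: z).
  split; first by rewrite memvD ?memvZ.
  - by rewrite memvD ?memvZ.
  - move=> e; apply: contra (hte e isT); rewrite linE linearD linearZ /= => /eqP/matrixP/(_ (c e) 0).
    by rewrite !mxE => ->.
  by apply: contra ht2 => /eqP /= /matrixP/(_ a b); rewrite !mxE => ->.
move=> sT; case/negP: zT.
have -> : z = t^-1 *: (y + t *: z - s *: y) + (t^-1 * (s - 1)) *: y.
  rewrite scalerBr scalerDr !scalerA mulVf // scale1r mulrBr mulr1 scalerBl.
  by rewrite addrA subrK addrC addKr.
by rewrite memv_add ?memvZ // memv_line.
Qed.

End Laman.

Theorem theorem2 (R : realType) (k : crystal) (G : sym_graph k)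
    (C : colored_graph k) (vrep : cvert C -> gvert G) (erep : cedge C -> gedge G)
    (hC : associated vrep erep) :
  generically erep (fun d : gedge G -> 'cV[R]_2 =>
    has_unique_faithful_realization d <-> colored_laman R C).
Proof.
have [v0 _] : exists v : cvert C, True.
  have [y _] : [set: gvert G] !=set0.
    by apply: infinite_setN0; case: (G).
  by have [[v g] _] := vrep_decomp hC y; exists v.
suff [f [[P fP] [x0 fx0] gf]] :
    generic (fun x : cedge C * 'I_2 -> R => unique_sol x <-> colored_laman R C).
  exists [set x | f x = 0].
    split; last by move=> /seteqP[_ /(_ x0 I) /= e]; rewrite e eqxx in fx0.
    exists [set P]; apply/seteqP; split=> x /= h; first by move=> _ ->; rewrite -fP.
    by rewrite fP; exact: h.
  by move=> d hd /eqP /gf u; exact: iff_trans (has_uniqueE hC hd) u.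
(* The Laman condition does not involve the directions. When it holds, generic directions have a
   unique solution; when only the edge count fails, no directions have one; when sparsity fails,
   generic directions have no faithful solution. *)
have [[em sp]|nl] := pselect ((#|cedge C|.+1 + T_ [set: Gam k] = \dim (configs R C))%N /\ sparse R C).
  apply: generic_sub (laman_unique v0 em sp) => x ux; split=> // _.
  exact/colored_lamanE.
have nL : ~ colored_laman R C by move=> /colored_lamanE.
have [sp|nsp] := pselect (sparse R C).
  apply: generic_all => x; split=> // ux; case: (sparse_not_unique v0 _ sp ux) => em.
  exact: nl.
by apply: generic_sub (not_sparse_collapsed nsp) => x h; split=> // -[y [fy _]]; case: (h y).
Qed.
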